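(* Let $\delta,\delta'\in\{\mathsf N,\mathsf D,\mathsf U,\mathsf X\}^n$ be two decorations with $\delta\preccurlyeq\delta'$. The surjection $\Psi_\delta^{\delta'}:\mathcal{PT}(\delta)\to\mathcal{PT}(\delta')$ defines a lattice homomorphism from the $\delta$-permutree lattice to the $\delta'$-permutree lattice.
   Context: Permutrees. A decoration of size $n$ is a word $\delta=\delta_1\cdots\delta_n$ in the symbols $\mathsf N$ (none), $\mathsf D$ (down), $\mathsf U$ (up), $\mathsf X$ (both). A permutree is a directed tree $T$ with $n$ vertices labeled bijectively by $[n]=\{1,\dots,n\}$ (vertices are identified with labels) in which each vertex has one or two parents (outgoing neighbors) and one or two children (incoming neighbors); a parent or child may be an unlabeled leaf (dangling edge), so ancestor and descendant subtrees may be empty. The ancestor (resp. descendant) subtree of $i$ through a given parent (resp. child) is the whole connected component, reached through it, of the tree with $i$ removed. If $i$ has two parents (resp. children), they are distinguished as left and right, and all labels in the left ancestor (resp. descendant) subtree of $i$ are smaller than $i$ while all labels in the right one are larger than $i$. The decoration of $T$ is given by $\delta(T)_i=\mathsf N,\mathsf D,\mathsf U,\mathsf X$ according to whether $i$ has (one parent, one child), (one parent, two children), (two parents, one child), (two parents, two children). $\mathcal{PT}(\delta)$ is the set of $\delta$-permutrees, i.e. permutrees with decoration $\delta$ (up to label-preserving isomorphism). Linear extensions. A linear extension of a permutree $T$ on $[n]$ is a permutation $\tau=\tau_1\cdots\tau_n$ such that $i$ appears before $j$ in $\tau$ for every edge $i\to j$ of $T$. For each decoration $\delta$, each permutation of $[n]$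 is a linear extension of a unique $\delta$-permutree. Refinement. Order the symbols by $\mathsf N\preccurlyeq\mathsf D\preccurlyeq\mathsf X$ and $\mathsf N\preccurlyeq\mathsf U\preccurlyeq\mathsf X$ ($\mathsf D,\mathsf U$ incomparable), and write $\delta\preccurlyeq\delta'$ if $\delta_i\preccurlyeq\delta'_i$ for all $i\in[n]$. When $\delta\preccurlyeq\delta'$, all linear extensions of a given $\delta$-permutree $T$ are linear extensions of one and the same $\delta'$-permutree; $\Psi_\delta^{\delta'}(T)$ denotes this $\delta'$-permutree. Permutree lattice. Let $i\to j$ be an edge of a $\delta$-permutree $T$ with $i<j$. Let $B$ be the only (resp. the right) descendant subtree of $i$ if $\delta_i\in\{\mathsf N,\mathsf U\}$ (resp. $\{\mathsf D,\mathsf X\}$), and $A$ the only (resp. the left) ancestor subtree of $j$ if $\delta_j\in\{\mathsf N,\mathsf D\}$ (resp. $\{\mathsf U,\mathsf X\}$). The increasing rotation of $i\to j$ transforms $T$ into the $\delta$-permutree $T'$ obtained by reversing the edge $i\to j$ into $j\to i$, attaching $A$ as ancestor subtree to $i$ (in the place of $j$) and $B$ as descendant subtree to $j$ (in the place of $i$). The $\delta$-permutree lattice is the order on $\mathcal{PT}(\delta)$ which is the reflexive transitive closure of the relations $T<T'$ for all increasing rotations $T\to T'$. *)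

(* Defs.v *)
From HB Require Import structures.
From mathcomp Require Import all_boot all_fingroup.

Set Implicit Arguments.
Unset Strict Implicit.
Unset Printing Implicit Defensive.

(* Labels range over 'I_n = {0, ..., n-1} instead of {1, ..., n}; only their
   order matters. *)

Inductive symbol := SN | SD | SU | SX.

(* (has two parents, has two children) *)
Definition symbol_code (s : symbol) : bool * bool :=
  match s with
  | SN => (false, false)
  | SD => (false, true)
  | SU => (true, false)
  | SX => (true, true)
  end.

Definition symbol_decode (c : bool * bool) : symbol :=
  match c with
  | (false, false) => SN
  | (false, true) => SD
  | (true, false) => SU
  | (true, true) => SX
  end.

Lemma symbol_codeK : cancel symbol_code symbol_decode.
Proof. by case. Qed.

HB.instance Definition _ := Finite.copy symbol (can_type symbol_codeK).

Definition symbol_le (a b : symbol) : bool :=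
  match a, b with
  | SN, _ | _, SX | SD, SD | SU, SU => true
  | _, _ => false
  end.

Definition decoration (n : nat) := {ffun 'I_n -> symbol}.

Definition refines (n : nat) (d d' : decoration n) : bool :=
  [forall i, symbol_le (d i) (d' i)].

(* The parents (or the children) of a vertex: [inl p] is a single one, and
   [inr (l, r)] a left one and a right one.  [None] is an unlabeled leaf. *)
Definition ports (n : nat) : Type :=
  (option 'I_n + option 'I_n * option 'I_n)%type.

(* The pair of the functions sending a vertex to its parents and to its
   children.  Since the vertices are their own labels, two such pairs are equal
   iff they are isomorphic as labeled structures. *)
Definition pretree (n : nat) : Type :=
  ({ffun 'I_n -> ports n} * {ffun 'I_n -> ports n})%type.

Section Permutrees.

Variable n : nat.
Implicit Types (T : pretree n) (s : ports n) (p q : option 'I_n) (i j k : 'I_n).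

Definition occurs k s : bool :=
  match s with
  | inl p => p == Some k
  | inr (l, r) => (l == Some k) || (r == Some k)
  end.

Definition leftmost s : option 'I_n :=
  match s with inl p => p | inr (l, _) => l end.

Definition rightmost s : option 'I_n :=
  match s with inl p => p | inr (_, r) => r end.

Definition set_leftmost s q : ports n :=
  match s with inl _ => inl q | inr (_, r) => inr (q, r) end.

Definition set_rightmost s q : ports n :=
  match s with inl _ => inl q | inr (l, _) => inr (l, q) end.

Definition relabel i j s : ports n :=
  let f p := if p == Some i then Some j else p in
  match s with inl p => inl (f p) | inr (l, r) => inr (f l, f r) end.

Definition parents T i : ports n := T.1 i.
Definition children T i : ports n := T.2 i.

Definition edge T : rel 'I_n := [rel i j | occurs j (parents T i)].

Definition adjacent T : rel 'I_n := [rel i j | edge T i j || edge T j i].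

(* The first conjunct excludes loops (take i = j) and pairs of opposite edges.
   A simple cycle of the underlying graph has at most n vertices; those of
   length 2 only run along an edge and back. *)
Definition is_directed_tree T : bool :=
  [&& [forall i, forall j, edge T i j ==> ~~ edge T j i],
      [forall i, forall j, connect (adjacent T) i j]
    & [forall m : 'I_n.+1, forall c : m.-tuple 'I_n,
         path.cycle (adjacent T) c && uniq c ==> (m <= 2)]].

(* The connected component containing p of T with i removed; it is the ancestor
   (descendant) subtree of i through p if p is a parent (child) of i. *)
Definition subtree T i p : {set 'I_n} :=
  if p is Some k then
    [set m | connect [rel x y | [&& adjacent T x y, x != i & y != i]] k m]
  else set0.

Definition separates T i s : bool :=
  if s is inr (l, r) then
    [forall k in subtree T i l, k < i] && [forall k in subtree T i r, i < k]
  else true.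

Definition is_permutree T : bool :=
  [&& [forall i, forall j,
         occurs j (parents T i) == occurs i (children T j)],
      is_directed_tree T
    & [forall i, separates T i (parents T i) && separates T i (children T i)]].

Definition decoration_of T : decoration n :=
  [ffun i => match parents T i, children T i with
             | inl _, inl _ => SN
             | inl _, inr _ => SD
             | inr _, inl _ => SU
             | inr _, inr _ => SX
             end].

(* tau is the word tau_0 ... tau_(n-1), so that tau^-1 i is the position of i. *)
Definition linear_extension T (tau : 'S_n) : Prop :=
  forall i j, edge T i j -> (tau^-1)%g i < (tau^-1)%g j.

(* The rotation of an edge i -> j with i < j.  If i has two parents then j is the
   right one, and if j has two children then i is the left one, so [rightmost]
   and [leftmost] designate the places of the edge as well as those of A and B.
   In [relabel], the root of A gets the child i in place of j, and the root of B
   gets the parent j in place of i. *)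
Definition rotate T i j : pretree n :=
  let A := leftmost (parents T j) in
  let B := rightmost (children T i) in
  ([ffun k => if k == i then set_rightmost (parents T i) A
              else if k == j then set_leftmost (parents T j) (Some i)
              else if Some k == B then relabel i j (parents T k)
              else parents T k],
   [ffun k => if k == i then set_rightmost (children T i) (Some j)
              else if k == j then set_leftmost (children T j) B
              else if Some k == A then relabel j i (children T k)
              else children T k]).

Definition permutree (d : decoration n) : Type :=
  {T : pretree n | is_permutree T && (decoration_of T == d)}.

Definition increasing_rotation (d : decoration n) : rel (permutree d) :=
  [rel T T' | [exists i : 'I_n, exists j : 'I_n,
     [&& i < j, edge (val T) i j & val T' == rotate (val T) i j]]].

(* [connect] is the reflexive transitive closure. *)
Definition permutree_le (d : decoration n) : rel (permutree d) :=
  connect (@increasing_rotation d).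

(* The equivalence states that Psi T is the only permutree with decoration d'
   having all linear extensions of T among its own. *)
Definition is_refinement_map (d d' : decoration n)
    (Psi : permutree d -> permutree d') : Prop :=
  forall (T : permutree d) (T' : permutree d'),
    Psi T = T' <->
    (forall tau, linear_extension (val T) tau -> linear_extension (val T') tau).

End Permutrees.

Section Lattices.

Definition is_meet (A : Type) (le : rel A) (x y m : A) : Prop :=
  [/\ le m x, le m y & forall z, le z x -> le z y -> le z m].

Definition is_join (A : Type) (le : rel A) (x y m : A) : Prop :=
  [/\ le x m, le y m & forall z, le x z -> le y z -> le m z].

Definition is_lattice (A : Type) (le : rel A) : Prop :=
  [/\ reflexive le, antisymmetric le, transitive le
    & forall x y, (exists m, is_meet le x y m) /\ (exists m, is_join le x y m)].

Definition is_lattice_hom (A B : Type) (leA : rel A) (leB : rel B)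
    (f : A -> B) : Prop :=
  forall x y m,
    (is_meet leA x y m -> is_meet leB (f x) (f y) (f m)) /\
    (is_join leA x y m -> is_join leB (f x) (f y) (f m)).

End Lattices.

(* Main.v *)
Require Import Defs.
From mathcomp Require Import all_boot all_fingroup.
From mathcomp Require Import zify.

(* For a linear extension r of a permutree T, call a vertex U (resp. D) if it has
   two parents (resp. two children).  A vertex x lies strictly below y in T iff r
   places u before v for all u, v with u = x or u a D vertex between x and y, and
   v = y or v a U vertex between u and y ([connect_forced], [forced_connect]).
   Indeed, U (D) vertices between x and y lie above x (below y) whenever x is below
   y; and if x is not below y, the path from x to y turns down at some u and then
   either never turns up again or does so at some v.
   Hence T is determined by r and its decoration, coarser decorations relate
   fewer pairs, and decreasing (increasing) relations can only appear (disappear)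
   along the weak order.  The linear extensions of T have a minimum and a maximum
   in the weak order, both monotone in T, and swapping adjacent letters of r
   either keeps T or rotates it.  So the map from linear orders to permutrees has
   adjoints on both sides and preserves joins and meets of the weak order; the
   lattice property and the homomorphism property of Psi follow. *)

Set Implicit Arguments.
Unset Strict Implicit.
Unset Printing Implicit Defensive.

(** Subtrees are awkward to handle through ports and components, so the combinatorics takes place on
    [oriented_tree], where a function [dir x], constant on each component left when [x] is removed,
    stands for them. This notion is stable under reversing all edges and all labels together, which
    exchanges parents with children and keeps increasing rotations increasing; one half of each
    argument therefore yields the other. The translation is needed in both directions, because the
    outcome of a rotation must be recognized as a permutree.

    Words are linear orders on the labels, given as relations; permutations come in only to check
    [is_refinement_map]. No permutree is built from a word by insertion: the path extended by the
    identity is carried to any word by adjacent swaps, each accompanied by a rotation when the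
    swapped pair is an edge.

    The join of two permutrees is read off the weak join of any linear extensions of them, not only
    of extremal ones. Extensions of [T] being extensions of its image, the same words compute the
    join on both sides of the refinement map. *)

Definition converse (I : Type) (E : rel I) : rel I := [rel x y | E y x].

Arguments converse I E /.

Definition sym_closure (I : Type) (E : rel I) : rel I := [rel x y | E x y || E y x].

Arguments sym_closure I E /.

Definition strict_connect (I : finType) (E : rel I) : rel I :=
  [rel x y | (x != y) && connect E x y].

Arguments strict_connect I E /.

(** [G] decides the pairs that [lt] leaves incomparable. Both the extremal linear extensions of a
    permutree and the weak join have this form. *)
Definition completion (I : Type) (G lt : rel I) : rel I :=
  [rel x y | lt x y || G x y && ~~ lt y x].

Arguments completion I G lt /.

Definition swap (I : eqType) (r : rel I) (i j : I) : rel I :=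
  [rel x y | if (x == i) && (y == j) then false
             else if (x == j) && (y == i) then true else r x y].

Arguments swap I r i j /.

Definition label_lt (n : nat) : rel 'I_n := [rel x y : 'I_n | x < y].

Arguments label_lt n /.

(** * Linear orders, the weak order and its joins *)

Section LinearOrders.

Variable I : finType.
Implicit Types (E G r s t lt : rel I) (x y z a b i j k : I).

Definition linear_order r : Prop :=
  [/\ irreflexive r, transitive r & forall x y, x != y -> r x y || r y x].

Definition between G x y z := (G x y && G y z) || (G z y && G y x).

Lemma linear_asym r x y : linear_order r -> r x y -> r y x = false.
Proof.
case=> irr tr _ rxy; apply/negP=> ryx; have := tr _ _ _ rxy ryx.
by rewrite irr.
Qed.

Lemma linear_neg r x y : linear_order r -> x != y -> ~~ r x y = r y x.
Proof.
move=> lr xy; case: (lr) => _ _ /(_ _ _ xy).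
by case/boolP: (r x y) => [/(linear_asym lr) -> | ].
Qed.

Lemma linear_neq r x y : linear_order r -> r x y -> x != y.
Proof. by case=> irr _ _ rxy; apply: contraTneq rxy => ->; rewrite irr. Qed.

Lemma converse_linear r : linear_order r -> linear_order (converse r).
Proof.
case=> irr tr tot; split=> [x|y x z /= xy yz|x y xy] /=.
- exact: irr.
- exact: tr yz xy.
- by rewrite orbC tot.
Qed.

Lemma between_converse G x y z : between (converse G) x y z = between G x y z.
Proof. by rewrite /between /= orbC; congr orb; rewrite andbC. Qed.

Lemma betweenC G x y z : between G x y z = between G z y x.
Proof. exact: orbC. Qed.

(** For a partial order [lt], this is the condition of Bjorner and Wachs for the linear extensions
    of a labeled poset to form an interval of the weak order. *)
Definition interpolating G lt : Prop :=
  forall x y z, lt x z -> between G x y z -> lt x y || lt y z.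

(** Only transitivity is at stake. If [lt x y], if [G y z] with [y], [z] not related the other way,
    and if [G z x], then [z] lies between [y] and [x]; interpolation gives [lt x z], because
    [lt z y] is excluded. The other mixed cases follow the same pattern. *)
Lemma completion_linear G lt :
    linear_order G -> irreflexive lt -> transitive lt -> interpolating G lt ->
  linear_order (completion G lt).
Proof.
move=> lG irr tr interp; have [irrG trG totG] := lG.
split=> [x|y x z /=|x y xy] /=.
- by rewrite irr irrG.
- case/orP=> [xy|/andP[xy nyx]]; case/orP=> [yz|/andP[yz nzy]].
  + by rewrite (tr _ _ _ xy yz).
  + have nzx : ~~ lt z x by apply: contra nzy => zx; apply: tr zx xy.
    have xz : x != z by apply: contraNneq nzy => <-.
    rewrite nzx andbT; case/orP: (totG _ _ xz) => [->|zx]; first by rewrite orbT.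
    have := interp _ z _ xy; rewrite /between zx yz orbT => /(_ isT).
    by rewrite (negbTE nzy) orbF => ->.
  + have nzx : ~~ lt z x by apply: contra nyx => zx; apply: tr yz zx.
    have xz : x != z by apply: contraNneq nyx => ->.
    rewrite nzx andbT; case/orP: (totG _ _ xz) => [->|zx]; first by rewrite orbT.
    have := interp _ x _ yz; rewrite /between zx xy orbT => /(_ isT).
    by rewrite (negbTE nyx) => /= ->.
  + rewrite (trG _ _ _ xy yz) orbC /=; apply/orP; left; apply/negP=> zx.
    have := interp _ y _ zx; rewrite /between xy yz orbT => /(_ isT).
    by rewrite (negbTE nyx) (negbTE nzy).
- case/orP: (totG _ _ xy) => Gxy; rewrite Gxy ?andTb ?andbT.
    by case: (lt y x); rewrite ?orbT.
  by case: (lt x y); rewrite ?orbT.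
Qed.

(* The weak order, when [G] is the order of the values. *)
Definition weak_le G r s : Prop := forall x y, G x y -> r y x -> s y x.

Lemma weak_le_trans G r s t : weak_le G r s -> weak_le G s t -> weak_le G r t.
Proof. by move=> rs st x y Gxy /(rs _ _ Gxy)/(st _ _ Gxy). Qed.

Lemma weak_le_converse G r s :
    linear_order G -> linear_order r -> linear_order s ->
  weak_le (converse G) r s -> weak_le G s r.
Proof.
move=> lG lr ls rs x y Gxy syx.
have nxy := linear_neq lG Gxy.
rewrite -(linear_neg lr nxy); apply: contraL syx => rxy.
by rewrite (linear_asym ls) // (rs _ _ Gxy).
Qed.

Lemma weak_le_anti G r s :
    linear_order G -> linear_order r -> linear_order s ->
  weak_le G r s -> weak_le G s r -> r =2 s.
Proof.
move=> lG lr ls rs sr.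
have [irr _ _] := lr; have [irs _ _] := ls; have [_ _ totG] := lG.
move=> x y; have [->|nxy] := eqVneq x y; first by rewrite irr irs.
have nyx : y != x by rewrite eq_sym.
case/orP: (totG _ _ nxy) => Gxy.
  rewrite -(linear_neg lr nyx) -(linear_neg ls nyx); congr (~~ _).
  by apply/idP/idP; [apply: rs|apply: sr].
by apply/idP/idP; [apply: rs|apply: sr].
Qed.

(* The inversions of the join are the transitive closure of the union. *)
Definition weak_join G r s : rel I :=
  completion G (strict_connect [rel x y | G y x && (r x y || s x y)]).

(** The closure consists of chains of inversions of [r] or [s], along which the values decrease. If
    the value [y] lies between the ends of a chain, either the chain visits [y] or one of its steps,
    from [x] to [w], jumps over [y]. That step is an inversion of one of the linear orders [r] and
    [s], in which [y] comes after [x] or before [w]; this is interpolation. *)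
Lemma weak_join_linear G r s :
    linear_order G -> linear_order r -> linear_order s ->
  linear_order (weak_join G r s).
Proof.
move=> lG lr ls; have [irG trG totG] := lG.
set Q : rel I := [rel x y | G y x && (r x y || s x y)].
have QG x y : connect Q x y -> (x == y) || G y x.
  case/connectP=> p; elim: p x => [|z p IH] x /= => [_ ->|]; first by rewrite eqxx.
  case/andP=> /andP[zx _] /IH{}IH /IH /predU1P[<-|yz]; first by rewrite zx orbT.
  by rewrite (trG _ _ _ yz zx) orbT.
apply: completion_linear => //= [x|y x z /= /andP[xy cxy] /andP[yz cyz]|].
- by rewrite /= eqxx.
- rewrite (connect_trans cxy cyz) andbT; apply: contraNneq xy => xz.
  have := QG _ _ cxy; have := QG _ _ cyz; rewrite -xz (eq_sym y).
  case: eqP => //= _ Gxy Gyx.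
  by have := trG _ _ _ Gxy Gyx; rewrite irG.
- move=> x y z /= /andP[xz cxz]; rewrite /between.
  have Gzx : G z x by have := QG _ _ cxz; rewrite (negbTE xz).
  have nG u v : G u v -> G v u = false by apply: linear_asym.
  case/orP=> /andP[Gzy Gyx].
    by have := trG _ _ _ Gzy Gyx; rewrite (nG _ _ Gzx).
  have {}xz := cxz.
  rewrite (eq_sym x) (linear_neq lG Gyx) (eq_sym y) (linear_neq lG Gzy) /=.
  case/connectP: cxz => p; elim: p x xz Gzx Gyx => [|w p IH] x xz Gzx Gyx /=.
    by move=> _ zx; move: Gzx; rewrite zx irG.
  case/andP=> Qxw pw lw; have cxw : connect Q x w by apply: connect1.
  have cwz : connect Q w z by apply/connectP; exists p.
  have [ywE|yw] := eqVneq w y; first by rewrite -ywE cxw.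
  case/orP: (totG _ _ yw) => [Gwy|Gyw]; last first.
    have Gzw := trG _ _ _ Gzy Gyw.
    case/orP: (IH _ cwz Gzw Gyw pw lw) => [wy|->]; last by rewrite orbT.
    by rewrite (connect_trans cxw wy).
  have {Qxw}/andP[Gwx rs] := Qxw.
  have split_inv (q : rel I) : linear_order q -> q x w -> q x y || q y w.
    move=> lq qxw; have [_ trq _] := lq.
    have nyx : y != x := linear_neq lG Gyx.
    case/boolP: (q x y) => //= nqxy.
    by apply: trq qxw; rewrite -(linear_neg lq) // eq_sym.
  have inv (q : rel I) : linear_order q -> (forall u v, q u v -> r u v || s u v) ->
      q x w -> connect Q x y || connect Q y z.
    move=> lq sub /(split_inv _ lq)/orP[qq|qq].
      by apply/orP; left; apply: connect1; rewrite /Q /= Gyx sub.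
    by apply/orP; right; apply: connect_trans cwz; apply: connect1; rewrite /Q /= Gwy sub.
  case/orP: rs; apply: inv => // u v ->; rewrite ?orbT //.
Qed.

Lemma weak_join_ub G r s : linear_order G ->
  weak_le G r (weak_join G r s) /\ weak_le G s (weak_join G r s).
Proof.
move=> lG; split=> x y Gxy ryx; rewrite /weak_join /= (eq_sym y).
  by rewrite (linear_neq lG Gxy) [connect _ _ _]connect1 //= Gxy ryx.
by rewrite (linear_neq lG Gxy) [connect _ _ _]connect1 //= Gxy ryx orbT.
Qed.

Lemma weak_join_least G r s t : linear_order G -> linear_order t ->
  weak_le G r t -> weak_le G s t -> weak_le G (weak_join G r s) t.
Proof.
move=> lG lt rt st x y Gxy; rewrite /weak_join /= (linear_asym lG Gxy) orbF.
case/andP=> yx /connectP[p]; have [_ trt _] := lt.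
elim: p y yx {Gxy} => [|z p IH] y yx /=; first by move=> _ xy; rewrite xy eqxx in yx.
case/andP=> /andP[Gzy rs] pz lz.
have tyz : t y z by case/orP: rs; [apply: rt|apply: st].
have [<-//|zx] := eqVneq z x.
exact: trt tyz (IH _ zx pz lz).
Qed.

Definition consecutive r i j : Prop :=
  r i j /\ forall k, r i k -> r k j -> False.

Lemma swap_linear r i j :
  linear_order r -> consecutive r i j -> linear_order (swap r i j).
Proof.
move=> lr [rij nk]; have [irr tr tot] := lr.
have nij := linear_neq lr rij.
have ik k : r i k -> k != j -> r j k.
  move=> rik kj; rewrite -(linear_neg lr kj); apply/negP => /nk; exact.
have kj k : r k j -> k != i -> r k i.
  move=> rkj; rewrite eq_sym => ki; rewrite -(linear_neg lr ki); apply/negP => /nk; exact.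
split=> [x|y x z|x y xy] /=.
- case: ifP => // _; case: ifP => [/andP[/eqP->]|_]; last exact: irr.
  by rewrite eq_sym (negbTE nij).
- have [->|xi] := eqVneq x i => /=.
    have [//|yj] := eqVneq y j => /=; rewrite (negbTE nij) /= => riy.
    have yi : y != i by rewrite eq_sym (linear_neq lr riy).
    rewrite (negbTE yi) /=.
    have [->|zj] := eqVneq z j => /=; last exact: tr.
    by move=> /(nk _ riy).
  have [->|xj] := eqVneq x j => /=.
    have [->|yi] := eqVneq y i => /=.
      move=> _; rewrite (negbTE nij) /=.
      have [//|zj riz] := eqVneq z j => /=.
      have [//|zi] := eqVneq z i => /=; exact: ik.
    move=> rjy; have yj : y != j by rewrite eq_sym (linear_neq lr rjy).
    have [//|zi] := eqVneq z i => /=; rewrite (negbTE yj) /=; exact: tr.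
  have [->|yi] := eqVneq y i => /=.
    rewrite (negbTE nij) /= => rxy.
    have [//|zj] := eqVneq z j => /=; exact: tr.
  have [->|yj] := eqVneq y j => /=; last exact: tr.
  have [-> rxj _|zi] := eqVneq z i => /=; [exact: kj|exact: tr].
- have := tot _ _ xy; have [->|xi] /= := eqVneq x i.
    have [->|yj] /= := eqVneq y j; first by rewrite (eq_sym j) (negbTE nij).
    by rewrite (negbTE nij) andbF.
  have [->|xj] /= := eqVneq x j; last by rewrite !andbF.
  by have [->|yi] /= := eqVneq y i; rewrite ?andbT ?andbF.
Qed.

Lemma swap_weak_le G r i j : linear_order G -> G i j -> weak_le G r (swap r i j).
Proof.
move=> lG Gij x y Gxy ryx /=; case: ifP => [/andP[/eqP yi /eqP xj]|_].
  by move: (linear_asym lG Gij); rewrite -yi -xj Gxy.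
by case: ifP.
Qed.

(** Among the pairs on which [r] and [s] disagree, take one with the fewest letters between its
    members in [r]. A letter [k] in between would give a closer such pair, since [s j i] forces
    [s k i] or [s j k]. *)
Lemma weak_le_consecutive G r s :
    linear_order G -> linear_order r -> linear_order s -> weak_le G r s ->
    ~ r =2 s ->
  exists i j, [/\ G i j, consecutive r i j & s j i].
Proof.
move=> lG lr ls rs neq.
have [_ _ totG] := lG; have [_ trs tots] := ls.
pose bad := [pred ij : I * I | r ij.1 ij.2 && s ij.2 ij.1].
have [ij0 bad0] : exists ij, bad ij.
  apply/existsP; apply: contraT => /existsPn nbad; case: neq.
  apply: (weak_le_anti lG) => // x y Gxy syx.
  have := nbad (x, y); rewrite /= syx andbT => nrxy.
  by rewrite -(linear_neg lr) // (linear_neq lG Gxy).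
pose f (ij : I * I) := #|[pred k | r ij.1 k && r k ij.2]|.
case: (arg_minnP f bad0) => -[i j] /= /andP[rij sji] fmin.
have badG x y : r x y -> s y x -> G x y.
  move=> rxy syx; case/orP: (totG _ _ (linear_neq lr rxy)) => // Gyx.
  by have := rs _ _ Gyx rxy; rewrite (linear_asym ls syx).
exists i, j; split; [exact: badG| |by []]; split=> // k rik rkj.
have [irr tr _] := lr.
have [ski|sik] : s k i \/ s j k.
  case/boolP: (s k i) => [|nki]; [by left|right].
  have ski : s i k by rewrite -(linear_neg ls) // eq_sym (linear_neq lr rik).
  exact: trs sji ski.
- have := fmin (i, k); rewrite /= rik ski => /(_ isT); rewrite leqNgt => /negP; apply.
  apply: proper_card; apply/properP; split.
    by apply/subsetP=> l; rewrite !inE => /andP[-> /tr->].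
  by exists k; rewrite !inE ?rik ?rkj // irr andbF.
- have := fmin (k, j); rewrite /= rkj sik => /(_ isT); rewrite leqNgt => /negP; apply.
  apply: proper_card; apply/properP; split.
    by apply/subsetP=> l; rewrite !inE => /andP[rkl ->]; rewrite (tr _ _ _ rik rkl).
  by exists k; rewrite !inE ?rik ?rkj // irr.
Qed.

(** Each swap removes one disagreement with [s]. Linear orders are only known to agree pointwise at
    the end, hence the invariance of [P] under [=2]. *)
Lemma weak_le_ind G (P : rel I -> Prop) r s :
    linear_order G -> linear_order r -> linear_order s -> weak_le G r s ->
    (forall q q', q =2 q' -> P q -> P q') ->
    (forall q i j, linear_order q -> G i j -> consecutive q i j ->
       P q -> P (swap q i j)) ->
  P r -> P s.
Proof.
move=> lG lr ls rs Pext Pswap.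
pose f (q : rel I) := #|[pred ij : I * I | q ij.1 ij.2 && s ij.2 ij.1]|.
have [m] := ubnP (f r); elim: m r lr rs => // m IH r lr rs fm Pr.
have [eq|/forallPn[x /forallPn[y neq]]] := boolP [forall x, forall y, r x y == s x y].
  by apply: Pext Pr => x y; move/forallP/(_ x)/forallP/(_ y)/eqP: eq.
have [] := weak_le_consecutive lG lr ls rs; first by move=> eq; rewrite eq eqxx in neq.
move=> i [j] [Gij cij sji]; have [rij _] := cij.
have nij := linear_neq lG Gij.
apply: (IH (swap r i j)); last exact: Pswap.
- exact: swap_linear.
- move=> u v Guv /=; case: ifP => // _; case: ifP => [/andP[/eqP-> /eqP-> //]|_].
  exact: rs.
- rewrite ltnS in fm; apply: leq_trans fm; apply: proper_card; apply/properP; split.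
    apply/subsetP=> -[u v]; rewrite !inE /=; case: ifP => // _.
    case: ifP => // /andP[/eqP-> /eqP->] /= sij.
    by rewrite (linear_asym ls sij) in sji.
  exists (i, j); rewrite !inE /= ?rij ?sji // !eqxx /=; done.
Qed.

End LinearOrders.

Section Between.

Variables (I : finType) (G : rel I) (lG : linear_order G).
Implicit Types x y z b : I.

Lemma between_neq x b y :
  between G x b y -> [/\ b != x, b != y & x != y].
Proof.
have [irG trG _] := lG; have nq := linear_neq lG.
case/orP=> /andP[p q]; have := trG _ _ _ p q => /nq pq; split=> //.
- by rewrite eq_sym nq.
- by rewrite nq.
- by rewrite nq.
- by rewrite eq_sym nq.
- by rewrite eq_sym.
Qed.

Lemma between_split x b y w :
  between G x b y -> b != w -> between G x b w || between G w b y.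
Proof.
have [_ _ totG] := lG; rewrite /between => + /totG.
by case/orP=> /andP[-> ->] /orP[->|->]; rewrite ?orbT ?andbT ?andTb ?orbT.
Qed.

Lemma between_same_side z x b y :
  b != z -> x != z -> y != z -> between G x b y -> G x z = G y z -> G b z = G x z.
Proof.
move=> bz xz yz; have [_ trG _] := lG; have neg := linear_neg lG.
have zb : z != b by rewrite eq_sym.
case/orP=> /andP[p q] xyz.
  case/boolP: (G b z) => [/(trG _ _ _ p) -> //|]; rewrite neg // => Gzb.
  have := trG _ _ _ Gzb q => Gzy; rewrite xyz; apply/esym; exact: linear_asym.
case/boolP: (G b z) => [/(trG _ _ _ p)|]; rewrite ?xyz ?neg // => Gzb.
rewrite -xyz.
have := trG _ _ _ Gzb q => Gzx; apply/esym; exact: linear_asym.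
Qed.

End Between.

(** * Oriented trees *)

Section OrientedTrees.

Variable I : finType.
Implicit Types (E G r : rel I) (dir : I -> I -> I) (U D : pred I).
Implicit Types (x y z w b u v m i j k : I).

(** The first clause treats both kinds of vertices at once: outside [U] its premise is vacuous, so
    that there is at most one neighbor, while in [U] there is at most one on each side. The second
    clause is the separation of labels by the subtrees. *)
Definition side G E dir U : Prop :=
  (forall x y z, E x y -> E x z -> (U x -> G y x = G z x) -> y = z) /\
  (forall x m, U x -> E x (dir x m) -> G m x = G (dir x m) x).

(* [dir x m] is the neighbor of [x] towards [m]; [U] and [D] are the vertices
   with two parents and with two children; [G] is the order of the labels. *)
Record oriented_tree G E dir U D : Prop := OrientedTree {
  tree_asym : forall x y, E x y -> E y x = false;
  dir_self : forall x, dir x x = x;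
  dir_adj : forall x m, x != m -> sym_closure E x (dir x m);
  adj_dir : forall x y, sym_closure E x y -> dir x y = y;
  dir_const : forall x a b, a != x -> b != x -> E a b -> dir x a = dir x b;
  tree_conn : forall x y, connect (sym_closure E) x y;
  tree_up : side G E dir U;
  tree_down : side G (converse E) dir D }.

Lemma side_converse G E dir U :
    linear_order G -> irreflexive E -> (forall x, dir x x = x) ->
  side G E dir U -> side (converse G) E dir U.
Proof.
move=> lG irE dxx [s1 s2]; have neg := linear_neg lG.
have nE x y : E x y -> y != x by apply: contraTneq => ->; rewrite irE.
split=> [x y z xy xz eq|x m Ux Ex] /=.
  apply: s1 (xy) (xz) _ => /eq /=; rewrite -(neg _ _ (nE _ _ xy)) -(neg _ _ (nE _ _ xz)).
  exact: negb_inj.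
have mx : m != x by apply: contraTneq Ex => ->; rewrite dxx irE.
by rewrite -(neg _ _ mx) -(neg _ _ (nE _ _ Ex)) s2.
Qed.

(** Labels are reversed together with edges so that an edge [i -> j] with [G i j] becomes an edge
    from [j] to [i] that is again increasing; the roles of [A] and [B] in its rotation are then
    exchanged. *)
Lemma oriented_tree_dual G E dir U D : linear_order G ->
  oriented_tree G E dir U D -> oriented_tree (converse G) (converse E) dir D U.
Proof.
move=> lG [as_ dxx da ad dc cn up dn].
have irE : irreflexive E by move=> x; apply/negP => /[dup] /as_ ->.
split=> //=.
- by move=> x y yx; apply: as_.
- by move=> x m /da; rewrite /= orbC.
- by move=> x y yx; apply: ad; rewrite /= orbC.
- by move=> x a b ax bx ba; apply/esym/dc.
- move=> x y; rewrite (eq_connect (e' := sym_closure E)) // => u v /=.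
  by rewrite orbC.
- exact: side_converse.
- exact: side_converse.
Qed.

(** * Paths and directions in an oriented tree *)

Section Directions.

Variables (G E : rel I) (dir : I -> I -> I) (U D : pred I).
Hypotheses (lG : linear_order G) (tE : oriented_tree G E dir U D).

Lemma tree_irr x : E x x = false.
Proof. by apply/negP => /[dup] /(tree_asym tE) ->. Qed.

Lemma edge_neq x y : E x y -> x != y.
Proof. by apply: contraTneq => ->; rewrite tree_irr. Qed.

Lemma dir_neq x m : x != m -> dir x m != x.
Proof.
move=> /(dir_adj tE) /=; apply: contraTneq => ->.
by rewrite tree_irr.
Qed.

Lemma dir_const_adj x a b :
  a != x -> b != x -> sym_closure E a b -> dir x a = dir x b.
Proof.
by move=> ax bx /orP[ab|ba]; [|apply/esym]; apply: (dir_const tE).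
Qed.

(** Removing the edge leaves two components, and [m] lies in exactly one of them. Along a walk from
    [x] to [m], the two sides of the equality change only together, when the walk crosses the
    edge. *)
Lemma dir_xor x y m : sym_closure E x y -> (dir x m == y) = (dir y m != x).
Proof.
move=> axy; have ayx : sym_closure E y x by rewrite /= orbC.
have nxy : x != y by case/orP: axy => /edge_neq //; rewrite eq_sym.
have Px : (dir x x == y) = (dir y x != x).
  by rewrite (dir_self tE) (adj_dir tE ayx) eqxx (negbTE nxy).
have Py : (dir x y == y) = (dir y y != x).
  by rewrite (dir_self tE) (adj_dir tE axy) eqxx eq_sym nxy.
have /connectP[p pm ->] := tree_conn tE x m.
suff step : forall a, path (sym_closure E) a p ->
  (dir x a == y) = (dir y a != x) ->
  (dir x (last a p) == y) = (dir y (last a p) != x) by exact: step.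
elim: p {pm} => [|b p IH] a //= /andP[ab pb] Pa; apply: IH => //.
have [->//|bx] := eqVneq b x; have [->//|byy] := eqVneq b y.
have [aE|ax] := eqVneq a x.
  move: ab; rewrite aE => xb; rewrite (adj_dir tE xb) (negbTE byy).
  by rewrite -(dir_const_adj _ _ xb) // (adj_dir tE ayx) eqxx.
have [aE|ay] := eqVneq a y.
  move: ab; rewrite aE => yb; rewrite (adj_dir tE yb) bx.
  by rewrite -(dir_const_adj _ _ yb) ?(adj_dir tE axy) ?eqxx // eq_sym.
by rewrite -(dir_const_adj _ _ ab) // -(dir_const_adj _ _ ab).
Qed.

(** Induction along the path to [j], without naming the path. The measure is the size of the
    component towards [j]; it loses at least the vertex [dir x j] at each step, as the path does not
    turn back. *)
Lemma walk_ind j (P : I -> Prop) :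
  P j -> (forall x, x != j -> P (dir x j) -> P x) -> forall x, P x.
Proof.
move=> Pj Pstep x; have [->//|] := eqVneq x j.
pose f z := #|[pred m | dir z m == dir z j]|.
have [k] := ubnP (f x); elim: k x => // k IH x fx xj; apply: Pstep => //.
have [->//|yj] := eqVneq (dir x j) j; apply: IH => //.
rewrite ltnS in fx; apply: leq_trans fx; set y := dir x j in yj *.
have axy : sym_closure E x y := dir_adj tE xj.
have nx : dir y j != x by rewrite -dir_xor // eqxx.
apply: proper_card; apply/properP; split.
  by apply/subsetP => m; rewrite !inE => /eqP ym; rewrite dir_xor // ym.
exists y; rewrite !inE ?(adj_dir tE axy) ?eqxx // (dir_self tE) eq_sym.
exact: dir_neq.
Qed.

Lemma connect_dir x y :
  connect E x y -> x != y -> E x (dir x y) && connect E (dir x y) y.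
Proof.
case/connectP=> p; elim: p x => [|w p IH] x /=; first by move=> _ ->; rewrite eqxx.
case/andP=> xw pw ly xy.
(* If [w] were not the direction of [y], the walk would return from [w] to [x] and follow the edge
   against its orientation. *)
have cwy : connect E w y by apply/connectP; exists p.
have [wE|wy] := eqVneq w y.
  by rewrite (adj_dir tE) -?wE ?xw ?connect0 //= xw.
have /andP[ww _] := IH _ pw ly wy.
suff -> : dir x y = w by rewrite xw.
apply/eqP; rewrite dir_xor /= ?xw //; apply: contraTneq ww => ->.
by rewrite (tree_asym tE).
Qed.

End Directions.

Section DirectedPaths.

Variables (G E : rel I) (dir : I -> I -> I) (U D : pred I).
Hypotheses (lG : linear_order G) (tE : oriented_tree G E dir U D).

Let tE' := oriented_tree_dual lG tE.
Let lG' := converse_linear lG.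

Lemma connect_converse x y : connect (converse E) x y = connect E y x.
Proof. by rewrite connect_rev. Qed.

Lemma connect_dir_down x y :
  connect E x y -> x != y -> E (dir y x) y && connect E x (dir y x).
Proof.
rewrite -connect_converse eq_sym => c n.
by have := connect_dir tE' c n; rewrite connect_converse.
Qed.

Lemma tree_anti x y : connect E x y -> connect E y x -> x = y.
Proof.
move=> xy yx; apply/eqP; apply: contraT => nxy.
have /andP[e1 _] := connect_dir tE xy nxy.
rewrite eq_sym in nxy.
have /andP[e2 _] := connect_dir_down yx nxy.
by have := tree_asym tE e1; rewrite e2.
Qed.

(** The vertex [k] lies on one of the two sides of the edge, and this makes it equivalent in
    reachability to the endpoint on that side. *)
Lemma edge_cover x y k :
  E x y -> connect E x k -> connect E k y -> (k == x) || (k == y).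
Proof.
move=> xy xk ky; have [//|kx] := eqVneq k x; have [//|kyn] := eqVneq k y.
have xkn : x != k by rewrite eq_sym.
have axy : sym_closure E x y by rewrite /= xy.
have /andP[_ c1] := connect_dir tE xk xkn.
have /andP[_ c2] := connect_dir_down ky kyn.
have := dir_xor tE k axy; case: eqP => [xE _|_].
  by rewrite xE in c1; rewrite (tree_anti ky c1) eqxx in kyn.
by move/esym/negbFE/eqP => yE; rewrite yE in c2; rewrite (tree_anti xk c2) eqxx in kx.
Qed.

(** Edges are the covers of the reachability order, so this order determines the tree. *)
Lemma edge_connect x y :
  E x y = [&& x != y, connect E x y &
             [forall k, connect E x k && connect E k y ==> (k == x) || (k == y)]].
Proof.
apply/idP/and3P => [xy|[nxy cxy /forallP cov]].
  split; [exact: (edge_neq tE)|exact: connect1|].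
  by apply/forallP=> k; apply/implyP => /andP[]; exact: edge_cover.
have /andP[e c] := connect_dir tE cxy nxy.
have := cov (dir x y); rewrite c connect1 //= eq_sym (negbTE (edge_neq tE e)) /=.
by move/eqP => yE; rewrite yE in e.
Qed.

(* [b] lies beyond [z] while [x] and [y] do not.  If the path from [z] to [b]
   turned down, the two children of the vertex where it does would separate [b]
   from both [x] and [y]. *)
Lemma crossing_up p z b x y :
    E p z -> dir p b = z -> dir z x = p -> (y = z \/ dir z y = p) ->
  between G x b y -> connect E z b.
Proof.
move=> + + + + bet; move: z p; apply: (walk_ind tE (j := b)) => [*|z zb IH p pz pb zx zy].
  exact: connect0.
have azp : sym_closure E z p by rewrite /= pz orbT.
have ww : dir z b != p by rewrite (dir_xor tE) // negbK pb.
have irE := tree_irr tE.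
have notz m : dir z m = p -> m != z.
  by move=> mz; apply: contraTneq pz => me; rewrite -mz me (dir_self tE) irE.
case/orP: (dir_adj tE zb) => e; last first.
  have [s1 s2] := tree_down tE.
  have [Dz neq] : D z /\ G (dir z b) z <> G p z.
    split.
      by apply: contraT => nD; case/eqP: ww; apply: (s1 z); rewrite // (negbTE nD).
    by move=> eq; case/eqP: ww; apply: (s1 z).
  have Gb : G b z = G (dir z b) z by apply: s2.
  have Gx : G x z = G p z by rewrite s2 ?zx.
  have bz : b != z by rewrite eq_sym.
  case: zy => [yz|zy].
    case: neq; rewrite -Gb -Gx; move: bet; rewrite yz.
    by case/orP=> /andP[p1 p2]; have [_ trG _] := lG; [rewrite p2 (trG _ _ _ p1 p2)|
      rewrite (linear_asym lG p1) (linear_asym lG (trG _ _ _ p1 p2))].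
  have Gy : G y z = G p z by rewrite s2 ?zy.
  case: neq; rewrite -Gb -Gx.
  by apply: (between_same_side lG bz (notz _ zx) (notz _ zy) bet); rewrite Gx.
have azw : sym_closure E z (dir z b) by rewrite /= e.
apply: connect_trans (connect1 e) _; apply: (IH z) => //.
  by apply/eqP; rewrite -[_ == _]negbK -(dir_xor tE) // zx eq_sym.
right; case: zy => [->|zy].
  by apply: (adj_dir tE); rewrite /= e orbT.
by apply/eqP; rewrite -[_ == _]negbK -(dir_xor tE) // zy eq_sym.
Qed.

End DirectedPaths.

Section Crossings.

Variables (G E : rel I) (dir : I -> I -> I) (U D : pred I).
Hypotheses (lG : linear_order G) (tE : oriented_tree G E dir U D).

Let tE' := oriented_tree_dual lG tE.
Let lG' := converse_linear lG.

(** The vertex [b] lies behind [y] or behind [x]; [crossing_up] settles the first case, and the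
    second one through the dual tree. *)
Lemma edge_between x y b :
  E x y -> between G x b y -> connect E y b || connect E b x.
Proof.
move=> xy bet.
have axy : sym_closure E x y by rewrite /= xy.
have ayx : sym_closure E y x by rewrite /= xy orbT.
have := dir_xor tE b axy; case: eqP => [xE _|_ /esym/negbFE/eqP yE].
  by rewrite (crossing_up lG tE xy xE _ _ bet) //; [apply: (adj_dir tE)|left].
rewrite -(connect_converse E x b) (crossing_up lG' tE' (p := y) (x := y) (y := x)) ?orbT //.
- exact: (adj_dir tE).
- by left.
- by rewrite between_converse betweenC.
Qed.

(** Were [b] below [x], then [x] and [y] would lie in the same ancestor subtree of [b], hence on the
    same side of its label. *)
Lemma edge_between_up x y b : U b -> E x y -> between G x b y -> connect E y b.
Proof.
move=> Ub xy bet; case/orP: (edge_between xy bet) => // bx.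
have [bxn byn _] := between_neq lG bet.
have /andP[e _] := connect_dir tE bx bxn.
have xb : x != b by rewrite eq_sym.
have yb : y != b by rewrite eq_sym.
have dE : dir b x = dir b y by apply: (dir_const tE).
have [_ s2] := tree_up tE.
have Gx : G x b = G (dir b x) b by apply: s2.
have Gy : G y b = G (dir b x) b by rewrite dE; apply: s2; rewrite -?dE.
move: bet; rewrite /between Gx Gy => /orP[]/andP[p1 p2].
  by have := linear_asym lG p2; rewrite Gy p1.
by have := linear_asym lG p2; rewrite Gx p1.
Qed.

(** Some edge of the directed path from [x] to [y] either reaches [b] or has the label [b] between
    its endpoints; [edge_between] applies to the latter. *)
Lemma tree_interpolating : interpolating G (strict_connect E).
Proof.
move=> x b y /= /andP[_ /connectP[p]] + + bet.
have [bx byn _] := between_neq lG bet.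
rewrite (eq_sym x) bx byn /=.
elim: p x bet {bx} => [|w p IH] x bet /= => [_ yE|/andP[xw pw] ly].
  by have [_ _] := between_neq lG bet; rewrite yE eqxx.
have cwy : connect E w y by apply/connectP; exists p.
have [->|bw] := eqVneq b w; first by rewrite connect1.
case/orP: (between_split lG bet bw) => bet'; last first.
  by case/orP: (IH _ bet' pw ly) => [/(connect_trans (connect1 xw)) ->|->]; rewrite ?orbT.
case/orP: (edge_between xw bet') => [/(connect_trans (connect1 xw)) -> //|bx].
by rewrite (connect_trans bx (connect_trans (connect1 xw) cwy)) orbT.
Qed.

Lemma connect_between_up x y b :
  U b -> connect E x y -> between G x b y -> connect E x b.
Proof.
move=> Ub /connectP[p]; elim: p x => [|w p IH] x /= => [_ -> bet|/andP[xw pw] ly bet].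
  by have [_ _] := between_neq lG bet; rewrite eqxx.
have [->|bw] := eqVneq b w; first exact: connect1.
apply: connect_trans (connect1 xw) _.
case/orP: (between_split lG bet bw) => bet'; last exact: IH.
exact: edge_between_up xw bet'.
Qed.

(* Either the path from [x] to [j] goes up all the way, or it goes up to [z]
   and then down. *)
Lemma up_walk j x : connect E x j \/
  exists z, [/\ connect E x z, z != j, E (dir z j) z &
    z = x \/ E (dir z x) z /\ dir z x != dir z j].
Proof.
move: x; apply: (walk_ind tE (j := j)) => [|x xj IH]; first by left.
case/orP: (dir_adj tE xj) => e; last by right; exists x; split=> //; left.
set w := dir x j in e IH.
case: IH => [wj|[z [wz zj ez zw]]].
  by left; apply: connect_trans wj; apply: connect1.
right; exists z; split=> //; first by apply: connect_trans wz; apply: connect1.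
have awx : sym_closure E w x by rewrite /= e orbT.
have axw : sym_closure E x w by rewrite /= e.
right; case: zw => [zE|[ew nw]].
  rewrite zE (adj_dir tE awx); split=> //.
  by rewrite eq_sym -(dir_xor tE) // eqxx.
have zwn : w != z.
  by apply: contraTneq ew => <-; rewrite (dir_self tE) (tree_irr tE).
have xz : x != z.
  apply: contraTneq ew => <-; rewrite (adj_dir tE axw).
  by rewrite (tree_asym tE).
by rewrite (dir_const tE (b := w) xz zwn e).
Qed.

Definition extends (r : rel I) E := forall x y, E x y -> r x y.

Lemma extends_connect r x y :
  linear_order r -> extends r E -> connect E x y -> x != y -> r x y.
Proof.
move=> [_ trr _] ext /connectP[p]; elim: p x => [|w p IH] x /=.
  by move=> _ ->; rewrite eqxx.
case/andP=> /ext xw pw ly xy; have [<-//|wy] := eqVneq w y.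
exact: trr xw (IH _ pw ly wy).
Qed.

End Crossings.

(** * Reading reachability off one linear extension *)

Definition forced G U D r x y : Prop :=
  forall u v, u = x \/ D u /\ between G x u y ->
              v = y \/ U v /\ between G u v y -> r u v.

Section ForcedRelations.

Variables (G E : rel I) (dir : I -> I -> I) (U D : pred I).
Hypotheses (lG : linear_order G) (tE : oriented_tree G E dir U D).

Let tE' := oriented_tree_dual lG tE.
Let lG' := converse_linear lG.

Lemma connect_between_down x y b :
  D b -> connect E x y -> between G x b y -> connect E b y.
Proof.
rewrite -!(connect_converse E) betweenC -between_converse => Db c bet.
by rewrite (connect_between_up lG' tE' Db c bet).
Qed.

Lemma down_walk j x : connect E j x \/
  exists z, [/\ connect E z x, z != j, E z (dir z j) &
    z = x \/ E z (dir z x) /\ dir z x != dir z j].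
Proof.
have [] := up_walk tE' j x; first by rewrite (connect_converse E); left.
by case=> z []; rewrite (connect_converse E); right; exists z.
Qed.

(** Used at the vertices where a path changes between going up and going down: both neighbors on the
    path are then parents, or both are children, so the vertex has two of them and they are on
    opposite sides of its label. *)
Lemma side_separates x y z (F : rel I) W : irreflexive F ->
    side G F dir W -> x != z -> y != z -> F z (dir z x) -> F z (dir z y) ->
  dir z x != dir z y -> W z /\ between G x z y.
Proof.
move=> irF [s1 s2] xz yz ex ey nxy.
have Wz : W z by apply: contraT => nW; case/eqP: nxy; apply: (s1 z); rewrite // (negbTE nW).
split=> //; have neq : G x z <> G y z.
  by move=> eq; case/eqP: nxy; apply: (s1 z) => // _; rewrite -!s2.
have neg := linear_neg lG; rewrite /between.
case/boolP: (G x z) neq => p; case/boolP: (G y z) => q //= _.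
  by rewrite -neg ?q // eq_sym.
by rewrite -neg ?p.
Qed.

Lemma connect_forced r x y :
  linear_order r -> extends r E -> strict_connect E x y -> forced G U D r x y.
Proof.
move=> lr ext /= /andP[nxy xy] u v uP vP.
have [nuy uy] : u != y /\ connect E u y.
  case: uP => [->//|[Du bet]]; have [_ n _] := between_neq lG bet.
  by split=> //; exact: connect_between_down xy bet.
case: vP => [->|[Uv bet]]; first exact: (extends_connect lr ext).
have [n _ _] := between_neq lG bet.
apply: (extends_connect lr ext); last by rewrite eq_sym.
exact: (connect_between_up lG tE Uv uy bet).
Qed.

Lemma forced_connect r x y :
    linear_order r -> extends r E -> x != y -> forced G U D r x y ->
  strict_connect E x y.
Proof.
move=> lr ext nxy forc /=; rewrite nxy /=.
have irE := tree_irr tE; have irr : irreflexive r by case: lr.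
have [//|[z1 [xz1 z1j e1 z1P]]] := up_walk tE y x.
have uP : z1 = x \/ D z1 /\ between G x z1 y.
  have [->|nz1x] := eqVneq z1 x; first by left.
  case: z1P => [->|[e n]]; [by left|right].
  apply: (side_separates (F := converse E)) => //; first exact: (tree_down tE).
  - by rewrite eq_sym.
  - by rewrite eq_sym.
have [jz1|[z2 [z2z1 z2j e2 z2P]]] := down_walk y z1.
  have yz1 : y != z1 by rewrite eq_sym.
  have := forc z1 y uP (or_introl erefl).
  by rewrite (linear_asym lr) // (extends_connect lr ext).
have n12 : z2 != z1.
  by apply: contraTneq e2 => ->; rewrite (tree_asym tE).
have vP : z2 = y \/ U z2 /\ between G z1 z2 y.
  case: z2P => [/eqP|[e n]]; first by rewrite (negbTE n12).
  right; apply: (side_separates (F := E)) => //; first exact: (tree_up tE).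
  - by rewrite eq_sym.
  - by rewrite eq_sym.
have := forc z1 z2 uP vP.
by rewrite (linear_asym lr) // (extends_connect lr ext).
Qed.

End ForcedRelations.

End OrientedTrees.

(** * Rotations *)

Section Rotation.

Variable I : finType.
Implicit Types (E G r : rel I) (dir : I -> I -> I) (U D : pred I).
Implicit Types (x y z w b u v m i j k : I).

(* The roots of the subtrees [A] and [B] of the rotation. *)
Definition rot_top G E U j : pred I := [pred y | E j y && (U j ==> G y j)].
Definition rot_bot G E D i : pred I := [pred y | E y i && (D i ==> G i y)].

Arguments rot_top G E U j /.
Arguments rot_bot G E D i /.

Definition rot_edge G E U D i j : rel I := [rel x y |
  [|| (x == j) && (y == i), (x == i) && rot_top G E U j y,
      rot_bot G E D i x && (y == j)
    | [&& E x y, ~~ ((x == i) && (y == j)), ~~ ((x == j) && rot_top G E U j y)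
        & ~~ (rot_bot G E D i x && (y == i))]]].

(** Away from [i] and [j], only the roots of [B] and [A] exchange a neighbor, [i] for [j] and [j]
    for [i]. Seen from [i], the subtree [B] is now behind [j], while [A], formerly behind [j], is
    entered directly through its root; symmetrically for [j]. *)
Definition rot_dir G E dir U D i j x m : I :=
  let A := rot_top G E U j in let B := rot_bot G E D i in
  if x == i then
    if B (dir i m) then j
    else if (dir i m == j) && A (dir j m) then dir j m else dir i m
  else if x == j then
    if A (dir j m) then i
    else if (dir j m == i) && B (dir i m) then dir i m else dir j m
  else if B x && (dir x m == i) then j
  else if A x && (dir x m == j) then i else dir x m.

Variant rot_edge_spec G E U D i j x y : Prop :=
| RotNew of x = j & y = i
| RotTop of x = i & rot_top G E U j y
| RotBot of rot_bot G E D i x & y = j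
| RotOld of E x y & (x = i -> y = j -> False)
    & (x = j -> rot_top G E U j y -> False)
    & (rot_bot G E D i x -> y = i -> False).

Lemma rot_edgeP G E U D i j x y :
  reflect (rot_edge_spec G E U D i j x y) (rot_edge G E U D i j x y).
Proof.
apply: (iffP idP) => [/or4P[/andP[/eqP-> /eqP->]|/andP[/eqP-> ty]
    |/andP[bx /eqP->]|/and4P[xy n1 n2 n3]]
  |[-> ->|-> ty|bx ->|xy n1 n2 n3]]; try apply/or4P.
- exact: RotNew.
- exact: RotTop.
- exact: RotBot.
- apply: RotOld => // [xi yj|xj ty|bx yi].
  + by rewrite xi yj !eqxx in n1.
  + by rewrite xj eqxx ty in n2.
  + by rewrite yi eqxx bx in n3.
- by constructor 1; rewrite !eqxx.
- by constructor 2; rewrite eqxx.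
- by constructor 3; rewrite bx eqxx.
- constructor 4; apply/and4P; split=> //.
  + by apply/negP => /andP[/eqP/n1 + /eqP].
  + by apply/negP => /andP[/eqP/n2].
  + by apply/negP => /andP[/n3 + /eqP].
Qed.

Section Rotated.

Variables (G E : rel I) (dir : I -> I -> I) (U D : pred I) (i j : I).
Hypotheses (lG : linear_order G) (tE : oriented_tree G E dir U D).
Hypotheses (Eij : E i j) (Gij : G i j).

Let A := rot_top G E U j.
Let B := rot_bot G E D i.
Let E' := rot_edge G E U D i j.
Let dir' := rot_dir G E dir U D i j.

Let asE := tree_asym tE.
Let irE := tree_irr tE.
Let nij : i != j := linear_neq lG Gij.
Let nji : j != i. Proof. by rewrite eq_sym. Qed.
Let Gji : G j i = false := linear_asym lG Gij.

Let AE y : A y -> E j y. Proof. by case/andP. Qed.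
Let BE y : B y -> E y i. Proof. by case/andP. Qed.

Lemma no_triangle x a b :
  sym_closure E x a -> sym_closure E x b -> sym_closure E a b -> False.
Proof.
move=> xa xb ab.
have nq u v : sym_closure E u v -> u != v.
  by apply: contraTneq => -> /=; rewrite irE.
have := dir_const_adj tE _ _ ab (x := x).
rewrite (adj_dir tE xa) (adj_dir tE xb) eq_sym nq // eq_sym nq // => /(_ isT isT) abE.
by have := nq _ _ ab; rewrite abE eqxx.
Qed.

Let symE u v : E u v -> sym_closure E u v. Proof. by move=> /= ->. Qed.
Let symV u v : E u v -> sym_closure E v u.
Proof. by move=> /= ->; rewrite orbT. Qed.

Let dE u v : E u v -> dir u v = v. Proof. by move/symE/(adj_dir tE). Qed.
Let dV u v : E u v -> dir v u = u. Proof. by move/symV/(adj_dir tE). Qed.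

Let nE u v : E u v -> u != v. Proof. exact: (edge_neq tE). Qed.
Let nV u v : E u v -> v != u. Proof. by rewrite eq_sym; exact: nE. Qed.

Let nAi : A i = false. Proof. by apply/negP => /AE; rewrite asE. Qed.
Let nAj : A j = false. Proof. by apply/negP => /AE; rewrite irE. Qed.
Let nBi : B i = false. Proof. by apply/negP => /BE; rewrite irE. Qed.
Let nBj : B j = false. Proof. by apply/negP => /BE; rewrite asE. Qed.

Let dir'i m : dir' i m = if B (dir i m) then j else
  if (dir i m == j) && A (dir j m) then dir j m else dir i m.
Proof. by rewrite /dir' /rot_dir eqxx. Qed.

Let dir'j m : dir' j m = if A (dir j m) then i else
  if (dir j m == i) && B (dir i m) then dir i m else dir j m.
Proof. by rewrite /dir' /rot_dir eqxx (negbTE nji). Qed.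

Let dir'x x m : x != i -> x != j -> dir' x m =
  if B x && (dir x m == i) then j else
  if A x && (dir x m == j) then i else dir x m.
Proof. by rewrite /dir' /rot_dir => /negbTE-> /negbTE->. Qed.

Let tri_ij k : sym_closure E k i -> sym_closure E k j -> False.
Proof. by move=> ki kj; apply: no_triangle ki kj (symE Eij). Qed.

Lemma rot_asym x y : E' x y -> E' y x = false.
Proof.
move=> xy; apply/negP => /rot_edgeP; case/rot_edgeP: xy.
- move=> -> ->; case=> [/eqP|_ |+ _|]; rewrite ?(negbTE nij) //.
  + by rewrite -/(A j) nAj.
  + by rewrite -/(B i) nBi.
  + by move=> _ /(_ erefl erefl).
- move=> -> Ay; have jy := AE Ay; case=> [yj|yi|_ /eqP|yi _ _ _].
  + by rewrite yj irE in jy.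
  + by rewrite yi asE in jy.
  + by rewrite (negbTE nij).
  + by apply: (tri_ij (k := y)); [apply: symE|apply: symV].
- move=> Bx ->; have xi := BE Bx; case=> [_ xiE|/eqP|Bj|jx _ _ _].
  + by rewrite xiE irE in xi.
  + by rewrite (negbTE nji).
  + by move: Bj; rewrite -/(B j) nBj.
  + by apply: (tri_ij (k := x)); [apply: symE|apply: symV].
- move=> xy n1 n2 n3; case=> [yj xi|yi Ax|By xj|yx _ _ _].
  + exact: n1.
  + by apply: (tri_ij (k := x)); [rewrite -yi; apply: symE|apply/symV/AE].
  + by apply: (tri_ij (k := y)); [apply/symE/BE|rewrite -xj; apply/symV].
  + by rewrite (asE xy) in yx.
Qed.

Lemma rot_dir_self x : dir' x x = x.
Proof.
have [->|xi] := eqVneq x i.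
  by rewrite dir'i (dir_self tE) nBi (negbTE nij).
have [->|xj] := eqVneq x j.
  by rewrite dir'j (dir_self tE) nAj (negbTE nji).
by rewrite dir'x // (dir_self tE) (negbTE xi) (negbTE xj) !andbF.
Qed.

Let E'ji : E' j i. Proof. exact/rot_edgeP/RotNew. Qed.
Let E'A y : A y -> E' i y. Proof. by move=> Ay; apply/rot_edgeP/RotTop. Qed.
Let E'B x : B x -> E' x j. Proof. by move=> Bx; apply/rot_edgeP/RotBot. Qed.

Let sym_old x w : sym_closure E x w ->
    ~ (x = i /\ w = j) -> ~ (x = j /\ w = i) ->
    ~ (x = i /\ B w) -> ~ (w = i /\ B x) -> ~ (x = j /\ A w) -> ~ (w = j /\ A x) ->
  sym_closure E' x w.
Proof.
move=> /= /orP[xw|wx] n1 n2 n3 n4 n5 n6; apply/orP; [left|right];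
  apply/rot_edgeP/RotOld => // *; tauto.
Qed.

Lemma rot_dir_adj x m : x != m -> sym_closure E' x (dir' x m).
Proof.
have [->|xi] := eqVneq x i => im.
  have := dir_adj tE im; rewrite dir'i; set w := dir i m.
  case: ifPn => [_ _|nB iw]; first by rewrite /= E'ji orbT.
  have [wj|wj] := eqVneq w j; last first.
    apply: sym_old => // [] [].
    + by move=> _ /eqP; rewrite (negbTE wj).
    + by move/eqP; rewrite (negbTE nij).
    + by rewrite (negbTE nB).
    + by rewrite nBi.
    + by move/eqP; rewrite (negbTE nij).
    + by rewrite nAi.
  by case: ifPn => [/E'A /= -> //|_]; rewrite wj /= E'ji orbT.
have [xE|xj] := eqVneq x j.
  rewrite xE in im *.
  have := dir_adj tE im; rewrite dir'j; set w := dir j m.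
  case: ifPn => [_ _|nA iw]; first by rewrite /= E'ji.
  have [wj|wj] := eqVneq w i; last first.
    apply: sym_old => // [] [].
    + by move/eqP; rewrite (negbTE nji).
    + by move=> _ /eqP; rewrite (negbTE wj).
    + by move/eqP; rewrite (negbTE nji).
    + by rewrite nBj.
    + by rewrite (negbTE nA).
    + by rewrite nAj.
  by case: ifPn => [/E'B /= ->|_]; rewrite ?orbT // wj /= E'ji.
have := dir_adj tE im; rewrite dir'x //; set w := dir x m.
case: ifPn => [/andP[/E'B Bx _] _|nB]; first by rewrite /= Bx.
case: ifPn => [/andP[/E'A Ax _] _|nA]; first by rewrite /= Ax orbT.
move=> xw; apply: sym_old => // [] [].
+ by move/eqP; rewrite (negbTE xi).
+ by move/eqP; rewrite (negbTE xj).
+ by move/eqP; rewrite (negbTE xi).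
+ by move=> wi Bx; rewrite Bx wi eqxx in nB.
+ by move/eqP; rewrite (negbTE xj).
+ by move=> wi Ax; rewrite Ax wi eqxx in nA.
Qed.

Let dir_ij x : x != i -> x != j -> dir x i = dir x j.
Proof. by move=> xi xj; apply: (dir_const tE) Eij; rewrite eq_sym. Qed.

Let dir_iA y : A y -> dir i y = j.
Proof.
move=> /AE jy; rewrite -(dE Eij); apply/esym/(dir_const tE) => //.
by apply: contraTneq jy => ->; rewrite asE.
Qed.

Let dir_jB x : B x -> dir j x = i.
Proof.
move=> /BE xi; rewrite -(dV Eij); apply/(dir_const tE) => //.
by apply: contraTneq xi => ->; rewrite asE.
Qed.

Let A_neq y : A y -> (y != i) && (y != j).
Proof. by move=> Ay; rewrite !(contraTneq _ Ay) // => ->; rewrite ?nAi ?nAj. Qed.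
Let B_neq y : B y -> (y != i) && (y != j).
Proof. by move=> Ay; rewrite !(contraTneq _ Ay) // => ->; rewrite ?nBi ?nBj. Qed.

Lemma rot_dir_edge x y : E' x y -> dir' x y = y /\ dir' y x = x.
Proof.
case/rot_edgeP.
- move=> -> ->; rewrite dir'i dir'j (dE Eij) (dV Eij) !(dir_self tE).
  by rewrite nAi nBi nBj nAj !andbF.
- move=> -> Ay; have /andP[yi yj] := A_neq Ay.
  rewrite dir'i dir'x // dir_iA // nBj eqxx (dE (AE Ay)) [A y]Ay; split=> //.
  have dy := dV (AE Ay); rewrite (dir_ij yi yj) dy eqxx (negbTE nji).
  by rewrite andbF.
- move=> Bx ->; have /andP[xi xj] := B_neq Bx.
  rewrite dir'j dir'x // dir_jB // nAi eqxx (dV (BE Bx)) [B x]Bx; split=> //.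
  by have dx := dE (BE Bx); rewrite -(dir_ij xi xj) dx eqxx.
- move=> xy n1 n2 n3; have yx := dV xy; have xyd := dE xy.
  split.
    have [xi|xi] := eqVneq x i.
      rewrite xi dir'i -xi xyd; case: ifPn => [/BE|_].
        by rewrite -xi asE.
      by case: eqP => // /(n1 xi).
    have [xj|xj] := eqVneq x j.
      rewrite xj dir'j -xj xyd; case: ifPn => [/(n2 xj) //|_].
      by case: eqP => // yi; move: xy; rewrite xj yi asE.
    rewrite dir'x // xyd; case: ifPn => [/andP[/n3 + /eqP]|_] //.
    by case: ifPn => // /andP[/AE jx /eqP yj]; rewrite yj asE in xy.
  have [yi|yi] := eqVneq y i.
    rewrite yi dir'i -yi yx; case: ifPn => [/n3 /(_ yi) //|_].
    by case: eqP => // xj; move: xy; rewrite xj yi asE.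
  have [yj|yj] := eqVneq y j.
    rewrite yj dir'j -yj yx; case: ifPn => [/AE|_].
      by rewrite -yj asE.
    by case: eqP => // xi; case: n1.
  rewrite dir'x // yx; case: ifPn => [/andP[/BE yiE /eqP xi]|_].
    by rewrite xi asE in xy.
  by case: ifPn => // /andP[Ay /eqP xj]; case: n2.
Qed.

Lemma rot_dir_const x a b :
  a != x -> b != x -> E' a b -> dir' x a = dir' x b.
Proof.
move=> ax bx /rot_edgeP.
have [xE|xi] := eqVneq x i.
  rewrite xE in ax bx *; rewrite !dir'i; case.
  - by move=> _ bi; rewrite bi eqxx in bx.
  - by move=> ai; rewrite ai eqxx in ax.
  - move=> Ba bj; rewrite bj (dE Eij) (dV (BE Ba)) [B a]Ba nBj.
    by rewrite (dir_self tE) nAj andbF.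
  - move=> ab n1 n2 n3.
    have <- : dir i a = dir i b by apply: (dir_const tE).
    have [aj|aj] := eqVneq a j.
      rewrite aj (dE Eij) nBj eqxx (dir_self tE) nAj; rewrite aj in ab n2.
      by case: ifPn => //; rewrite dE // => /n2 -/(_ erefl).
    have [bj|bj] := eqVneq b j; last first.
      by rewrite (dir_const tE aj bj ab).
    rewrite bj in ab *; rewrite (dir_self tE) nAj (dV ab).
    case: ifP => // _; rewrite andbF; case: ifPn => // /andP[_ /AE].
    by rewrite asE.
have [xE|xj] := eqVneq x j.
  rewrite xE in ax bx *; rewrite !dir'j; case.
  - by move=> aj; rewrite aj eqxx in ax.
  - move=> -> Ab; rewrite (dV Eij) (dE (AE Ab)) [A b]Ab nAi.
    by rewrite (dir_self tE) nBi andbF.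
  - by move=> _ bj; rewrite bj eqxx in bx.
  - move=> ab n1 n2 n3.
    have <- : dir j a = dir j b by apply: (dir_const tE).
    have [bi|bi] := eqVneq b i.
      rewrite bi in ab n3 *; rewrite (dir_self tE) nBi (dV ab).
      case: ifPn => // _; rewrite andbF; case: ifPn => // /andP[_ Ba].
      by case: (n3 Ba).
    have [ai|ai] := eqVneq a i; last first.
      by rewrite (dir_const tE ai bi ab).
    rewrite ai in ab *; rewrite (dir_self tE) nBi (dE ab).
    case: ifP => // _; rewrite andbF; case: ifPn => // /andP[_ /BE].
    by rewrite asE.
rewrite !dir'x // => sp; suff -> : dir x a = dir x b by [].
case: sp.
- by move=> -> ->; rewrite dir_ij.
- move=> aE Ab; rewrite aE dir_ij //.
  by apply: (dir_const tE) (AE Ab); rewrite // eq_sym.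
- move=> Ba ->; rewrite -dir_ij //.
  by apply: (dir_const tE) (BE Ba); rewrite // eq_sym.
- by move=> ab _ _ _; apply: (dir_const tE).
Qed.

Lemma rot_conn x y : connect (sym_closure E') x y.
Proof.
have symc : connect_sym (sym_closure E').
  by apply: sym_connect_sym => u v /=; rewrite orbC.
have stepE u v : E u v -> connect (sym_closure E') u v.
  move=> uv.
  have c1 a b : E' a b -> connect (sym_closure E') a b.
    by move=> ab; apply: connect1; rewrite /= ab.
  case/boolP: (E' u v) => [/c1 //|nE'].
  have [[ui vj]|n1] : (u = i /\ v = j) \/ ~ (u = i /\ v = j).
    by case: (eqVneq u i) (eqVneq v j) => [->|/eqP ?] [->|/eqP ?]; tauto.
    by rewrite ui vj symc c1.
  have [ujE|uj] := boolP ((u == j) && A v).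
    case/andP: ujE => /eqP-> Av.
    by apply: connect_trans (c1 _ _ E'ji) (c1 _ _ (E'A Av)).
  have [viE|vi] := boolP (B u && (v == i)).
    case/andP: viE => Bu /eqP->.
    by apply: connect_trans (c1 _ _ (E'B Bu)) (c1 _ _ E'ji).
  case/negP: nE'; apply/rot_edgeP/RotOld => // [ui vj|ujE Av|Bu viE].
  - by case: n1.
  - by case/negP: uj; rewrite ujE eqxx.
  - by case/negP: vi; rewrite viE eqxx andbT.
have := tree_conn tE x y; apply: connect_sub => u v /= /orP[|] /stepE //.
by rewrite symc.
Qed.

Let neg x y : x != y -> ~~ G x y = G y x. Proof. exact: linear_neg. Qed.

(** Seen from [i], the subtree [A] is behind the right parent [j], which is why it may replace [j]
    as right ancestor subtree. *)
Lemma rot_top_side y : U i -> A y -> G y i = false.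
Proof.
move=> Ui Ay; have [_ s2] := tree_up tE.
by rewrite s2 ?dir_iA ?Gji.
Qed.

Let Gup y : E i y -> y != j -> U i && G y i.
Proof.
move=> iy yj; have [s1 _] := tree_up tE.
apply: contraT => nUG; case/eqP: yj; apply: (s1 i) => // Ui.
by move: nUG; rewrite Ui Gji /= => /negbTE.
Qed.

Let Gupj y : E j y -> ~ A y -> U j && ~~ G y j.
Proof.
move=> jy; rewrite /A /= jy /=; case: (U j) => //=.
by case: (G y j) => // /(_ isT).
Qed.

(** Both [i] and [j] are in the same ancestor subtree of [x]. Hence the root of [B] keeps its left
    and right parents in order when [j] replaces [i]. *)
Lemma rot_same_side x : U x -> E x i -> x != j -> G i x = G j x.
Proof.
move=> Ux xi xj; have [_ s2] := tree_up tE.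
have xin := nE xi; have dx : dir x j = i by rewrite -dir_ij // dE.
by rewrite (s2 x j) ?dx.
Qed.

(** After the rotation [i] is a parent of [j] on the smaller side. What remains behind it, apart
    from [i] itself, is reached through the left child or the left parent of [i], so it is smaller
    than [i] and thus than [j]. *)
Let below m : dir j m = i -> B (dir i m) = false -> G m j.
Proof.
move=> jm nB; have [_ trG _] := lG.
have [->//|mi] := eqVneq m i.
suff Gmi : G m i by apply: trG Gmi Gij.
have im : i != m by rewrite eq_sym.
have wj : dir i m != j by rewrite (dir_xor tE) ?jm ?eqxx //; apply: symE.
case/orP: (dir_adj tE im) => e.
  have /andP[Ui Gw] := Gup e wj.
  by have [_ s2] := tree_up tE; rewrite s2.
have [_ s2] := tree_down tE.
move: nB; rewrite /B /= e /=; case Di: (D i) => //= nG.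
by rewrite s2 // -neg ?nG // nV.
Qed.

Lemma rot_side : side G E' dir' U.
Proof.
have [s1 s2] := tree_up tE; split.
  move=> x y z /rot_edgeP xy /rot_edgeP xz.
  have [xE|xi] := eqVneq x i.
    rewrite xE in xy xz *.
    have {}xy : E i y /\ y <> j \/ A y.
      case: xy => [/eqP|_ Ay|Bi|iy n1 _ _]; [by rewrite (negbTE nij)|by right| |].
        by move: Bi; rewrite -/(B i) nBi.
      by left; split=> // /n1; apply.
    have {}xz : E i z /\ z <> j \/ A z.
      case: xz => [/eqP|_ Ay|Bi|iy n1 _ _]; [by rewrite (negbTE nij)|by right| |].
        by move: Bi; rewrite -/(B i) nBi.
      by left; split=> // /n1; apply.
    case: xy => [[iy /eqP yj]|Ay]; case: xz => [[iz /eqP zj]|Az] eqG.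
    - exact: s1 eqG.
    - have /andP[Ui Gy] := Gup iy yj.
      by have := eqG Ui; rewrite Gy (rot_top_side Ui Az).
    - have /andP[Ui Gz] := Gup iz zj.
      by have := eqG Ui; rewrite Gz (rot_top_side Ui Ay).
    - apply: (s1 j); [exact: AE|exact: AE|move=> Uj].
      by move: Ay Az; rewrite /A /= Uj => /andP[_ /= ->] /andP[_ /= ->].
  have [xE|xj] := eqVneq x j.
    rewrite xE in xy xz *.
    have {}xy : y = i \/ E j y /\ ~ A y.
      case: xy => [_ ->|/eqP|Bj|jy _ n2 _]; [by left|by rewrite (negbTE nji)| |].
        by move: Bj; rewrite -/(B j) nBj.
      by right; split=> // /n2; apply.
    have {}xz : z = i \/ E j z /\ ~ A z.
      case: xz => [_ ->|/eqP|Bj|jy _ n2 _]; [by left|by rewrite (negbTE nji)| |].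
        by move: Bj; rewrite -/(B j) nBj.
      by right; split=> // /n2; apply.
    case: xy => [->|[jy Ay]]; case: xz => [-> //|[jz Az]] eqG.
    - have /andP[Uj Gz] := Gupj jz Az.
      by have := eqG Uj; rewrite Gij (negbTE Gz).
    - have /andP[Uj Gy] := Gupj jy Ay.
      by have := eqG Uj; rewrite Gij (negbTE Gy).
    - exact: s1 eqG.
  have {}xy : B x /\ y = j \/ E x y /\ (B x -> y <> i).
    case: xy => [/eqP|/eqP|Bx ->|xy _ _ n3]; rewrite ?(negbTE xi) ?(negbTE xj) //.
    + by left.
    + by right.
  have {}xz : B x /\ z = j \/ E x z /\ (B x -> z <> i).
    case: xz => [/eqP|/eqP|Bx ->|xz _ _ n3]; rewrite ?(negbTE xi) ?(negbTE xj) //.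
    + by left.
    + by right.
  case: xy => [[Bx ->]|[xy ny]]; case: xz => [[Bx' ->//]|[xz nz]] eqG.
  - case: (nz Bx); apply/esym/(s1 x) => //; first exact: BE.
    by move=> Ux; rewrite rot_same_side ?eqG //; apply: BE.
  - case: (ny Bx'); apply/(s1 x) => //; first exact: BE.
    by move=> Ux; rewrite rot_same_side -?eqG //; apply: BE.
  - exact: s1 eqG.
move=> x m Ux; have [->|xm] := eqVneq m x; first by rewrite rot_dir_self.
have {}xm : x != m by rewrite eq_sym.
have := dir_adj tE xm.
have [xE|xi] := eqVneq x i.
  rewrite xE in Ux xm *; rewrite dir'i.
  case: ifPn => [_ _|nB]; first by rewrite (rot_asym E'ji).
  case: ifPn => [/andP[/eqP dj Aw] _ _|nA iw /rot_edgeP[/eqP|_ Aw|Bi|e n1 _ _]].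
  - by rewrite (s2 i m) ?dj // Gji (rot_top_side Ux Aw).
  - by rewrite (negbTE nij).
  - by case: (no_triangle (x := i) iw (symE Eij)); apply/symV/AE.
  - by move: Bi; rewrite -/(B i) nBi.
  - exact: s2.
have [xE|xj] := eqVneq x j.
  rewrite xE in Ux xm *; rewrite dir'j.
  case: ifPn => [Aw _ _|/negP nA].
    rewrite Gij s2 //; last exact: AE.
    by move: Aw; rewrite /A /= Ux => /andP[].
  case: ifPn => [/andP[_ Bw] _ /rot_edgeP[_ wi|/eqP|Bj|e _ _ _]|nB jw].
  - by rewrite wi nBi in Bw.
  - by rewrite (negbTE nji).
  - by move: Bj; rewrite -/(B j) nBj.
  - by case: (tri_ij (symE (BE Bw))); apply: symV.
  case/rot_edgeP=> [_ wi|/eqP|Bj|e _ _ _].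
  - by move: nB; rewrite wi eqxx Gij /= => /negbTE nB; rewrite below.
  - by rewrite (negbTE nji).
  - by move: Bj; rewrite -/(B j) nBj.
  - exact: s2.
rewrite dir'x //; case: ifPn => [/andP[Bx /eqP wi] _ _|nB].
  by rewrite s2 ?wi ?BE // rot_same_side // BE.
case: ifPn => [/andP[Ax _] _ /rot_edgeP[/eqP|/eqP|Bx|xi' _ _ _]|nA xw].
- by rewrite (negbTE xj).
- by rewrite (negbTE xi).
- by case: (tri_ij (symE (BE Bx))); apply/symV/AE.
- by case: (tri_ij (symE xi')); apply/symV/AE.
case/rot_edgeP=> [/eqP|/eqP|Bx wj|e _ _ _].
- by rewrite (negbTE xj).
- by rewrite (negbTE xi).
- by rewrite wj in xw; case: (tri_ij (symE (BE Bx))).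
- exact: s2.
Qed.

End Rotated.

Lemma side_ext G E E1 dir dir1 U : E =2 E1 -> (forall x m, dir x m = dir1 x m) ->
  side G E dir U -> side G E1 dir1 U.
Proof.
move=> eE ed [s1 s2]; split=> [x y z|x m]; rewrite -?eE -?ed; [exact: s1|exact: s2].
Qed.

(** The condition on parents is [rot_side]. The condition on children is [rot_side] for the dual
    tree and its edge from [j] to [i], whose rotation is the dual of the given one. *)
Lemma rot_tree G E dir U D i j :
    linear_order G -> oriented_tree G E dir U D -> E i j -> G i j ->
  oriented_tree G (rot_edge G E U D i j) (rot_dir G E dir U D i j) U D.
Proof.
move=> lG tE Eij Gij.
have up := rot_side lG tE Eij Gij.
have tE' := oriented_tree_dual lG tE; have lG' := converse_linear lG.
have nij := linear_neq lG Gij.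
split=> //.
- exact: (rot_asym lG tE Eij Gij).
- exact: (rot_dir_self lG tE Gij).
- exact: (rot_dir_adj lG tE Eij Gij).
- by move=> x y /orP[] /(rot_dir_edge lG tE Eij Gij)[].
- exact: (rot_dir_const lG tE Eij Gij).
- exact: (rot_conn i j tE).
have irE' : irreflexive (rot_edge (converse G) (converse E) D U j i).
  by move=> x; apply/negP => /[dup] /(rot_asym lG' tE' Eij Gij) ->.
have := side_converse lG' irE' (rot_dir_self lG' tE' Gij) (rot_side lG' tE' Eij Gij).
apply: side_ext => x y /=; last first.
  rewrite /rot_dir; have [->|xi] := eqVneq x i; first by rewrite ?eqxx (negbTE nij).
  have [_|xj] // := eqVneq x j.
  case: (eqVneq (dir x y) j) => [->|]; rewrite ?andbF //=.
  by rewrite (eq_sym j) (negbTE nij) andbF.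
rewrite /rot_edge /= -[E y i && _]/(rot_bot G E D i y) -[E j x && _]/(rot_top G E U j x).
move: (rot_bot _ _ _ _ _) (rot_top _ _ _ _ _) (E y x) => b t e.
by case: (x == i); case: (x == j); case: (y == i); case: (y == j); case: b; case: t; case: e.
Qed.

End Rotation.

(** * Permutrees and the weak order *)

Section WeakOrder.

Variable I : finType.
Implicit Types (E G r s : rel I) (dir : I -> I -> I) (U D : pred I).
Implicit Types (x y z w b u v m i j k : I).

Lemma between_down G x b y :
  linear_order G -> G y x -> between G x b y -> G y b /\ G b x.
Proof.
move=> lG yx /orP[/andP[xb bY]|/andP[]//]; have [_ trG _] := lG.
by have := linear_asym lG yx; rewrite (trG _ _ _ xb bY).
Qed.

(** When [G y x], every tested pair satisfies [G v u], so each test asks for an inversion, and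
    inversions persist upwards in the weak order. *)
Lemma forced_weak_le G U D r s x y : linear_order G -> weak_le G r s ->
  G y x -> forced G U D r x y -> forced G U D s x y.
Proof.
move=> lG rs yx forc u v uP vP.
have yu : G y u by case: uP => [->//|[_ /(between_down lG yx)[]]].
suff vu : G v u by apply: rs vu (forc _ _ uP vP).
by case: vP => [->//|[_ /(between_down lG yu)[]]].
Qed.

Lemma forced_converse G U D r x y :
  forced G U D r x y <-> forced (converse G) U D r x y.
Proof.
by split=> forc u v uP vP; apply: forc; [move: uP|move: vP|move: uP|move: vP];
  rewrite between_converse.
Qed.

Lemma strict_connect_irr E : irreflexive (strict_connect E).
Proof. by move=> x; rewrite /= eqxx. Qed.

Lemma strict_connect_connect E x y :
  connect E x y = (x == y) || strict_connect E x y.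
Proof. by rewrite /=; have [->|_] := eqVneq x y; rewrite ?connect0. Qed.

Section Extremal.

Variables (G E : rel I) (dir : I -> I -> I) (U D : pred I).
Hypotheses (lG : linear_order G) (tE : oriented_tree G E dir U D).

Lemma strict_connect_trans : transitive (strict_connect E).
Proof.
move=> y x z /= /andP[xy cxy] /andP[yz cyz].
rewrite (connect_trans cxy cyz) andbT; apply: contraNneq xy => xz.
by rewrite (tree_anti lG tE cxy) // xz.
Qed.

(* The minimal linear extension for [H = G], the maximal one for
   [H = converse G]. *)
Definition extremal (H F : rel I) : rel I := completion H (strict_connect F).

Lemma extremal_linear : linear_order (extremal G E).
Proof.
apply: completion_linear lG (@strict_connect_irr E) strict_connect_trans _.
exact: (tree_interpolating lG tE).
Qed.

Lemma extremal_extends (H : rel I) : extends (extremal H E) E.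
Proof.
by move=> x y xy; rewrite /extremal /= (edge_neq tE xy) connect1.
Qed.

Lemma extremal_least (H r : rel I) : linear_order H -> linear_order r ->
  extends r E -> weak_le H (extremal H E) r.
Proof.
move=> lH lr ext x y Hxy.
rewrite /extremal /= (linear_asym lH Hxy) orbF => /andP[yx c].
exact: (extends_connect lr ext).
Qed.

(* List the vertices below [j] other than [i], then [i], then [j], then the rest:
   since the edge [i -> j] is a cover, this is compatible with [E]. *)
Lemma edge_consecutive_extension i j : E i j ->
  exists r, [/\ linear_order r, extends r E & consecutive r i j].
Proof.
move=> eij; have nij := edge_neq tE eij.
have nji : j != i by rewrite eq_sym.
have lM := extremal_linear; have eM := extremal_extends (G).
set M := extremal G E in lM eM; have [irM trM totM] := lM.
pose key x := if x == i then 1 else if x == j then 2 else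
  if connect E x j then 0 else 3.
pose r : rel I := [rel x y | (key x < key y) || (key x == key y) && M x y].
have ki : key i = 1 by rewrite /key eqxx.
have kj : key j = 2 by rewrite /key eqxx (negbTE nji).
have k1 x : key x = 1 -> x = i.
  by rewrite /key; case: eqP => // _; case: ifP => // _; case: ifP.
have k2 x : key x = 2 -> x = j.
  by rewrite /key; case: ifP => // _; case: eqP => // _; case: ifP.
exists r; split.
- split=> [x|y x z|x y xy]; rewrite /r /=.
  + by rewrite ltnn eqxx irM.
  + case/orP=> [xy|/andP[/eqP-> xy]]; case/orP=> [yz|/andP[/eqP<- yz]].
    * by rewrite (ltn_trans xy yz).
    * by rewrite xy.
    * by rewrite yz.
    * by rewrite eqxx (trM _ _ _ xy yz) orbT.
  + by case: ltngtP => //= _; apply: totM.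
- move=> x y xy; have Mxy := eM _ _ xy; rewrite /r /= Mxy andbT.
  rewrite orbC -leq_eqVlt /key.
  have [yi|yi] := eqVneq y i.
    have xj : connect E x j.
      by apply: connect_trans (connect1 xy) _; rewrite yi connect1.
    have nxj : x != j.
      apply: contraTneq xy => ->; rewrite yi; apply/negP => ji.
      by have := tree_asym tE ji; rewrite eij.
    by rewrite xj (negbTE nxj); case: ifP.
  have [yj|yj] := eqVneq y j.
    have [//|xi] := eqVneq x i; have [//|xj] := eqVneq x j.
    by rewrite -yj connect1.
  case: (boolP (connect E y j)) => [yjc|_]; last by do 3!case: ifP => // _.
  have xj : connect E x j by apply: connect_trans (connect1 xy) yjc.
  have [xi|xi] := eqVneq x i.
    have := edge_cover lG tE eij (k := y); rewrite -xi connect1 // => /(_ isT yjc).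
    by rewrite xi (negbTE yi) (negbTE yj).
  have [xjE|xjn] := eqVneq x j; last by rewrite xj.
  by rewrite -(tree_anti lG tE yjc) ?eqxx // -?xjE ?connect1 // xjE eqxx in yj.
- rewrite /consecutive /r /= ki kj; split=> // k; case E1: (key k) => [|[|[|[|?]]]] //=.
  + by rewrite (k1 _ E1) irM.
  + by rewrite (k2 _ E1) irM.
Qed.

End Extremal.

Section Comparison.

Variables (G E E1 : rel I) (dir dir1 : I -> I -> I) (U D U1 D1 : pred I).
Hypotheses (lG : linear_order G).
Hypotheses (tE : oriented_tree G E dir U D) (tE1 : oriented_tree G E1 dir1 U1 D1).

Lemma common_extension_sub r : linear_order r -> extends r E -> extends r E1 ->
    (forall x, U x -> U1 x) -> (forall x, D x -> D1 x) ->
  forall x y, strict_connect E1 x y -> strict_connect E x y.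
Proof.
move=> lr e e1 UU DD x y /[dup] c /andP[nxy _].
apply: (forced_connect lG tE lr e nxy) => u v uP vP.
apply: (connect_forced lG tE1 lr e1 c).
- by case: uP => [|[/DD ? ?]]; [left|right].
- by case: vP => [|[/UU ? ?]]; [left|right].
Qed.

Lemma strict_connect_edge : strict_connect E =2 strict_connect E1 -> E =2 E1.
Proof.
move=> eq x y.
have eqc u v : connect E u v = connect E1 u v by rewrite !strict_connect_connect eq.
rewrite (edge_connect lG tE) (edge_connect lG tE1) eqc.
by congr [&& _, _ & _]; apply: eq_forallb => k; rewrite !eqc.
Qed.

End Comparison.

Section Monotone.

Variables (G E E1 : rel I) (dir dir1 : I -> I -> I) (U D : pred I).
Hypotheses (lG : linear_order G).
Hypotheses (tE : oriented_tree G E dir U D) (tE1 : oriented_tree G E1 dir1 U D).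

Lemma common_extension_eq r :
  linear_order r -> extends r E -> extends r E1 -> E =2 E1.
Proof.
move=> lr e e1; apply: (strict_connect_edge lG tE tE1) => x y.
by apply/idP/idP; [apply: (common_extension_sub lG tE1 tE lr)|
  apply: (common_extension_sub lG tE tE1 lr)].
Qed.

(** The inversions of the minimal extension are the decreasing relations of the tree, and the
    non-inversions of the maximal one are the increasing relations. Going from [r] to [s] can only
    add to the former and remove from the latter. *)
Lemma extremal_mono r s :
    linear_order r -> linear_order s -> extends r E -> extends s E1 ->
  weak_le G r s ->
  weak_le G (extremal G E) (extremal G E1) /\
  weak_le G (extremal (converse G) E) (extremal (converse G) E1).
Proof.
move=> lr ls e e1 rs.
have down x y : G y x -> strict_connect E x y -> strict_connect E1 x y.
  move=> yx /[dup] c /andP[nxy _].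
  apply: (forced_connect lG tE1 ls e1 nxy); apply: (forced_weak_le lG rs yx).
  exact: (connect_forced lG tE).
have sr : weak_le (converse G) s r.
  by apply: weak_le_converse => //; apply: converse_linear.
have up x y : G x y -> strict_connect E1 x y -> strict_connect E x y.
  move=> xy /[dup] c /andP[nxy _].
  apply: (forced_connect lG tE lr e nxy); apply/forced_converse.
  apply: (forced_weak_le (converse_linear lG) sr xy); apply/forced_converse.
  exact: (connect_forced lG tE1).
split=> x y Gxy; rewrite /extremal.
  have := linear_asym lG Gxy; rewrite /completion /= => ->; rewrite !orbF.
  exact: down.
rewrite /completion /= Gxy /=.
case/orP=> [/(down _ _ Gxy) /= ->//|nxy]; apply/orP; right.
apply: contra nxy; exact: up.
Qed.

End Monotone.

Lemma swap_extends r E i j : ~~ E i j -> extends r E -> extends (swap r i j) E.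
Proof.
move=> nij ext x y xy /=; case: ifP => [/andP[/eqP xi /eqP yj]|_].
  by rewrite -xi -yj xy in nij.
by case: ifP => // _; apply: ext.
Qed.

(** The edges created from [i] to the root of [A] and from the root of [B] to [j] hold in [r] by
    transitivity through [i -> j], and the swap does not affect these pairs. *)
Lemma rot_swap_extends r G E dir U D i j :
    linear_order r -> oriented_tree G E dir U D -> E i j -> i != j ->
    extends r E -> consecutive r i j ->
  extends (swap r i j) (rot_edge G E U D i j).
Proof.
move=> lr tE eij nij ext [rij cons] x y; have [irr trr _] := lr.
have nji : j != i by rewrite eq_sym.
have asE := tree_asym tE.
case/rot_edgeP=> /=.
- by move=> -> ->; rewrite (negbTE nji) !eqxx.
- move=> -> /andP[jy _]; rewrite eqxx (negbTE nij) /=.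
  have [yj|_] := eqVneq y j; first by rewrite yj (tree_irr tE) in jy.
  exact: trr rij (ext _ _ jy).
- case/andP=> xi _ ->; rewrite (negbTE nji) andbF eqxx andbT.
  have [xE|_] := eqVneq x i; first by rewrite xE (tree_irr tE) in xi.
  exact: trr (ext _ _ xi) rij.
- move=> xy n1 _ _; case: ifP => [/andP[/eqP/n1 + /eqP]//|_].
  by case: ifP => // _; apply: ext.
Qed.

End WeakOrder.

(** * Permutrees as oriented trees *)

Section Pretrees.

Variable n : nat.
Implicit Types (T : pretree n) (s : ports n) (d : decoration n).
Implicit Types (x y z w b u v m i j k : 'I_n) (F : rel 'I_n) (W : pred 'I_n).

Lemma label_lt_linear : linear_order (@label_lt n).
Proof.
split=> [x|y x z|x y xy] /=; [exact: ltnn|exact: ltn_trans|].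
by rewrite -neq_ltn.
Qed.

Definition two_ports s := if s is inr _ then true else false.

Definition two_parents d : pred 'I_n := [pred x | (symbol_code (d x)).1].
Definition two_children d : pred 'I_n := [pred x | (symbol_code (d x)).2].

Lemma two_parentsE T x : two_parents (decoration_of T) x = two_ports (parents T x).
Proof.
rewrite /two_parents /two_children /= ffunE.
by case: (parents T x) => ?; case: (children T x).
Qed.

Lemma two_childrenE T x : two_children (decoration_of T) x = two_ports (children T x).
Proof.
rewrite /two_parents /two_children /= ffunE.
by case: (parents T x) => ?; case: (children T x).
Qed.

Lemma decoration_ofP T d :
    (forall x, two_parents d x = two_ports (parents T x)) ->
    (forall x, two_children d x = two_ports (children T x)) ->
  decoration_of T = d.
Proof.
move=> pE cE; apply/ffunP => x; apply: (can_inj symbol_codeK).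
rewrite [LHS]surjective_pairing [RHS]surjective_pairing.
congr (_, _); first by have := pE x; rewrite -two_parentsE.
by have := cE x; rewrite -two_childrenE.
Qed.

(** The local part of [separates], comparing [x] with its neighbors only; in an oriented tree it
    implies the condition on whole subtrees. *)
Definition sided x s : bool :=
  if s is inr (l, r) then
    (if l is Some k then k < x else true) && (if r is Some k then x < k else true)
  else true.

Lemma sidedP x s y : sided x s -> occurs y s -> two_ports s ->
  (leftmost s == Some y) = (y < x) /\ (rightmost s == Some y) = (x < y).
Proof.
case: s => // -[l r] /= /andP[lx rx] oy _.
have ly : l == Some y -> y < x by move/eqP => lE; rewrite lE in lx.
have ry : r == Some y -> x < y by move/eqP => rE; rewrite rE in rx.
case: eqP oy ly => [_ _ /(_ isT) yx|_ /= rE _].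
  rewrite yx; split=> //; rewrite ltnNge (ltnW yx) /=; apply/negP => /ry.
  by rewrite ltnNge (ltnW yx).
by have xy := ry rE; rewrite rE xy [y < x]ltnNge (ltnW xy).
Qed.

Section FromPermutree.

Variables (T : pretree n) (pT : is_permutree T).

Let av x := [rel u v | [&& adjacent T u v, u != x & v != x]].

(** In a permutree, the default of [odflt] is never reached, by [directionP]. *)
Definition direction x m : 'I_n :=
  if m == x then x else
  odflt x [pick k | adjacent T x k && (m \in subtree T x (Some k))].

Let coherent x y : occurs y (parents T x) = occurs x (children T y).
Proof. by case/and3P: pT => /forallP/(_ x)/forallP/(_ y)/eqP. Qed.

Lemma permutree_edgeC x y : edge T x y = occurs x (children T y).
Proof. exact: coherent. Qed.

Lemma permutree_asym x y : edge T x y -> edge T y x = false.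
Proof.
case/and3P: pT => _ /and3P[/forallP/(_ x)/forallP/(_ y)/implyP as_ _ _] _ xy.
exact/negbTE/as_.
Qed.

Let adjC x y : adjacent T x y = adjacent T y x.
Proof. by rewrite /adjacent /= orbC. Qed.

Let adj_neq x y : adjacent T x y -> y != x.
Proof.
apply: contraTneq => ->; rewrite /adjacent /= orbb.
by apply/negP => /[dup] /permutree_asym ->.
Qed.

Let avC x : connect_sym (av x).
Proof. by apply: sym_connect_sym => u v; rewrite /av /= adjC [(u != x) && _]andbC. Qed.

(** A simple path from [k] to another neighbor of [x] that avoids [x] closes up through [x] into a
    simple cycle of length at least 3. Being without repetition, the cycle has at most [n] vertices
    and so falls under the acyclicity test. *)
Let adj_uniq x k k' :
  adjacent T x k -> adjacent T x k' -> connect (av x) k k' -> k = k'.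
Proof.
move=> xk + /connectP[p0 pp0 k'E]; rewrite {k'}k'E.
case/shortenP: pp0 => p pp up _ xk'.
have xp : x \notin p.
  elim: {up xk'} p {1}k pp => // u q IH k0 /= /andP[/and3P[_ _ ux] /IH].
  by rewrite inE negb_or eq_sym ux.
have adjp : path (adjacent T) k p.
  by apply: sub_path pp => u v /and3P[].
pose c := x :: k :: p.
have uc : uniq c.
  by rewrite /c cons_uniq inE negb_or eq_sym adj_neq //= xp; move: up.
have sc : size c < n.+1.
  by rewrite ltnS; have := max_card (mem c); rewrite (card_uniqP uc) card_ord.
have cc : path.cycle (adjacent T) c.
  by rewrite /c /= rcons_path adjp xk adjC.
case/and3P: pT => _ /and3P[_ _ /forallP/(_ (Ordinal sc))] + _.
move/forallP/(_ (@Tuple _ 'I_n c (eqxx _))); rewrite cc uc /=.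
by case: (p).
Qed.

Lemma directionP x m : x != m ->
  adjacent T x (direction x m) && (m \in subtree T x (Some (direction x m))).
Proof.
move=> xm; rewrite /direction eq_sym (negbTE xm); case: pickP => //= no.
case/and3P: pT => _ /and3P[_ /forallP/(_ x)/forallP/(_ m) + _] _.
case/connectP=> p0 pp0 mE; case/shortenP: pp0 mE => -[|k p] pp up _ mE.
  by rewrite mE eqxx in xm.
case/andP: pp => xk pp; move: (no k); rewrite xk inE.
case/negP; apply/connectP; exists p => //.
move: up; rewrite /= inE negb_or => /andP[/andP[xk' xp] _].
elim: p {xk xm mE no} k pp xp xk' => //= u p IH k /andP[ku pu].
rewrite inE negb_or => /andP[xu xp] xk.
by rewrite (eq_sym k) xk (eq_sym u) xu IH // ku.
Qed.

(** Abstracting the edge relation and the ports lets one proof serve parents and children. *)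
Lemma permutree_side F (P : 'I_n -> ports n) W :
    (forall x y, F x y = occurs y (P x)) -> (forall x, separates T x (P x)) ->
    (forall x, W x = two_ports (P x)) -> irreflexive F ->
  side (@label_lt n) F direction W.
Proof.
move=> FE sep WE irF; split=> [x y z|x m Wx].
  rewrite !FE WE; move: (sep x); case: (P x) => [p _ /eqP-> /eqP[]//|[l r]] /=.
  have sub k : k \in subtree T x (Some k) by rewrite inE connect0.
  move=> /andP[/forallP lx /forallP rx].
  have ly k : l == Some k -> k < x.
    by move/eqP => lE; move: (lx k); rewrite lE sub.
  have ry k : r == Some k -> x < k.
    by move/eqP => rE; move: (rx k); rewrite rE sub.
  move=> /orP[yl|yr] /orP[zl|zr] /(_ isT) eq.
  - by move/eqP: yl; rewrite (eqP zl) => -[].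
  - by move: eq; rewrite (ly _ yl) ltnNge ltnW // ry.
  - by move: eq; rewrite (ly _ zl) ltnNge ltnW // ry.
  - by move/eqP: yr; rewrite (eqP zr) => -[].
have [->|xm] := eqVneq x m; first by rewrite {1}/direction eqxx irF.
have /andP[_ sm] := directionP xm; set k := direction x m in sm *.
have sk : k \in subtree T x (Some k) by rewrite inE connect0.
move: Wx; rewrite FE WE; move: (sep x); case: (P x) => // -[l r] /=.
move=> /andP[/forallP lx /forallP rx] _ /orP[]/eqP kE.
  by move: (lx m) (lx k); rewrite kE sm sk /= => -> ->.
move: (rx m) (rx k); rewrite kE sm sk /= => r1 r2.
by rewrite [m < x]ltnNge [k < x]ltnNge (ltnW r1) (ltnW r2).
Qed.

Lemma permutree_tree d : decoration_of T = d ->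
  oriented_tree (@label_lt n) (edge T) direction (two_parents d) (two_children d).
Proof.
move=> dT; have pP : forall x, two_parents d x = two_ports (parents T x).
  by move=> x; rewrite -dT two_parentsE.
have cP : forall x, two_children d x = two_ports (children T x).
  by move=> x; rewrite -dT two_childrenE.
have sep x : separates T x (parents T x) && separates T x (children T x).
  by case/and3P: pT => _ _ /forallP.
have irE : irreflexive (edge T).
  by move=> x; apply/negP => /[dup] /permutree_asym ->.
have dir x m : x != m ->
    adjacent T x (direction x m) /\ connect (av x) (direction x m) m.
  by move/directionP; rewrite inE => /andP[].
split=> //.
- exact: permutree_asym.
- by move=> x; rewrite /direction eqxx.
- by move=> x m /dir[].
- move=> x y xy; have xny : x != y by rewrite eq_sym adj_neq.
  by have [a c] := dir _ _ xny; exact: adj_uniq a xy c.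
- move=> x a b0 ax bx ab; have xa : x != a by rewrite eq_sym.
  have xb : x != b0 by rewrite eq_sym.
  have [a1 c1] := dir _ _ xa; have [a2 c2] := dir _ _ xb.
  apply: adj_uniq a1 a2 _; apply: connect_trans c1 _; rewrite avC in c2.
  apply: connect_trans c2; apply: connect1.
  by rewrite /av /= ax bx /adjacent /= ab.
- by case/and3P: pT => _ /and3P[_ /forallP cn _] _ x y; move/forallP: (cn x).
- by apply: permutree_side pP irE => x; case/andP: (sep x).
- apply: permutree_side cP _ => [x y|x|x]; last exact: irE.
  + exact: permutree_edgeC.
  + by case/andP: (sep x).
Qed.

Lemma permutree_sided x : sided x (parents T x) && sided x (children T x).
Proof.
have sub k : k \in subtree T x (Some k) by rewrite inE connect0.
have sepS s : separates T x s -> sided x s.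
  case: s => // -[l r] /= /andP[/forallP lx /forallP rx]; apply/andP; split.
    by case: l lx => // k /(_ k); rewrite sub.
  by case: r rx => // k /(_ k); rewrite sub.
by case/and3P: pT => _ _ /forallP/(_ x)/andP[/sepS-> /sepS->].
Qed.

End FromPermutree.

Section ToPermutree.

Variables (T : pretree n) (dir : 'I_n -> 'I_n -> 'I_n) (U D : pred 'I_n).
Hypothesis tT : oriented_tree (@label_lt n) (edge T) dir U D.

Let dir_path x k m : k != x ->
  connect [rel u v | [&& adjacent T u v, u != x & v != x]] k m -> dir x k = dir x m.
Proof.
move=> kx /connectP[p]; elim: p k kx => [|w p IH] k kx /=; first by move=> _ ->.
case/andP=> /and3P[kw _ wx] pw ly.
by rewrite (dir_const_adj tT kx wx kw) (IH _ wx pw ly).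
Qed.

(** Every vertex of the subtree through [k] is in direction [k] from [x], so it is on the same side
    of [x] as [k]. *)
Lemma side_separates_ports F x s W :
    side (@label_lt n) F dir W -> irreflexive F ->
    (forall y, F x y -> adjacent T x y) -> (forall y, F x y = occurs y s) ->
    W x = two_ports s -> sided x s ->
  separates T x s.
Proof.
move=> [_ s2] irF FA FE WE; case: s => // -[l r] /= in FE WE *.
have key k m : F x k -> m \in subtree T x (Some k) -> m != x /\ (m < x) = (k < x).
  move=> xk; rewrite inE => c; have axk := FA _ xk.
  have kx : k != x by apply: contraTneq xk => ->; rewrite irF.
  have dk : dir x m = k by rewrite -(dir_path kx c) (adj_dir tT).
  split; last by rewrite -dk; apply: s2; rewrite ?dk ?WE.
  apply: contraNneq kx => mx; rewrite -dk mx; exact/eqP/(dir_self tT).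
case/andP=> ls rs; apply/andP; split; apply/forallP => m; apply/implyP.
  case: l FE ls => [k|] FE ls; last by rewrite inE.
  by case/key => [|_ ->]; rewrite ?FE ?eqxx.
case: r FE rs => [k|] FE rs; last by rewrite inE.
case/key => [|mx]; rewrite ?FE ?eqxx ?orbT // [k < x]ltnNge (ltnW rs) /= => mxF.
by move: mx; rewrite neq_ltn mxF.
Qed.

Lemma tree_permutree :
    (forall x y, occurs y (parents T x) = occurs x (children T y)) ->
    (forall x, U x = two_ports (parents T x)) ->
    (forall x, D x = two_ports (children T x)) ->
    (forall x, sided x (parents T x)) -> (forall x, sided x (children T x)) ->
  is_permutree T.
Proof.
move=> coh UE DE sp sc; have irE : irreflexive (edge T) := tree_irr tT.
apply/and3P; split.
- by apply/forallP=> x; apply/forallP => y; rewrite coh.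
- apply/and3P; split.
  + apply/forallP=> x; apply/forallP => y; apply/implyP => xy.
    by rewrite (tree_asym tT).
  + by apply/forallP=> x; apply/forallP => y; apply: (tree_conn tT).
  + apply/forallP => -[m lem] /=; apply/forallP => -[c /= /eqP sz].
    apply/implyP => /andP[]; rewrite -sz.
    case: c {sz} => [|x [|y [|z q]]] // + /and3P[xn yn _].
    set p := z :: q.
    rewrite -[path.cycle _ _]/(adjacent T x y && path (adjacent T) y (rcons p x)).
    rewrite rcons_path => /and3P[xy pp lx].
    have adjp : path [rel u v | [&& adjacent T u v, u != x & v != x]] y p.
      move: xn; rewrite inE negb_or -/p => /andP[nxy].
      elim: (p) (y) pp nxy => //= u p' IH y' /andP[yu pu] xy'.
      rewrite inE negb_or => /andP[xu xp].
      by rewrite (eq_sym y') xy' (eq_sym u) xu IH // yu.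
    have yx : y != x by rewrite eq_sym; move: xn; rewrite inE negb_or => /andP[].
    have c : connect [rel u v | [&& adjacent T u v, u != x & v != x]] y (last y p).
      by apply/connectP; exists p.
    (* The second and the last vertex of the cycle are both adjacent to [x] and are joined by a path
       avoiding [x]. Being in the same direction they coincide, against the absence of
       repetitions. *)
    have := dir_path yx c; rewrite (adj_dir tT xy) (adj_dir tT) => [eq|].
      by case/negP: yn; rewrite [y]eq; apply: (mem_last z q).
    by rewrite /= orbC.
- apply/forallP => x; apply/andP; split.
  + apply: (side_separates_ports (tree_up tT) irE) => // y.
    by rewrite /adjacent /= => ->.
  + apply: (side_separates_ports (tree_down tT)) => // y.
      by rewrite /adjacent /= => ->; rewrite orbT.
    by rewrite -coh.
Qed.

End ToPermutree.

End Pretrees.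

Lemma oriented_tree_ext (I : finType) (G E E1 : rel I) dir U D : E =2 E1 ->
  oriented_tree G E dir U D -> oriented_tree G E1 dir U D.
Proof.
move=> eE [as_ dxx da ad dc cn up dn].
have eS : sym_closure E =2 sym_closure E1 by move=> x y; rewrite /= !eE.
split=> //.
- by move=> x y; rewrite -!eE; apply: as_.
- by move=> x m /da; rewrite eS.
- by move=> x y; rewrite -eS; apply: ad.
- by move=> x a b ax bx; rewrite -eE; apply: dc.
- by move=> x y; rewrite -(eq_connect eS).
- exact: side_ext up.
- by apply: side_ext dn => // x y; apply: eE.
Qed.

(** * Ports as sets of neighbors *)

Section Ports.

Variable n : nat.
Implicit Types (s : ports n) (p q : option 'I_n) (x y a b : 'I_n).

(** The right-hand side has the shape of [rot_top]: a single port carries no condition on its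
    label. *)
Lemma leftmostE x s y : sided x s ->
  (leftmost s == Some y) = occurs y s && (two_ports s ==> (y < x)).
Proof.
case: s => [p|[l r] sd]; first by rewrite andbT.
have := sidedP sd (y := y); case: (boolP (occurs _ _)) => [_ /(_ isT isT)[-> _] //|].
by rewrite /= negb_or => /andP[/negbTE->].
Qed.

Lemma rightmostE x s y : sided x s ->
  (rightmost s == Some y) = occurs y s && (two_ports s ==> (x < y)).
Proof.
case: s => [p|[l r] sd]; first by rewrite andbT.
have := sidedP sd (y := y); case: (boolP (occurs _ _)) => [_ /(_ isT isT)[_ ->] //|].
by rewrite /= negb_or => /andP[_ /negbTE->].
Qed.

Lemma occurs_set_leftmost x s q y : sided x s ->
  occurs y (set_leftmost s q) = (q == Some y) || occurs y s && (leftmost s != Some y).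
Proof.
case: s => [p|[l r] sd] /=; first by rewrite andbN orbF.
have := sidedP sd (y := y) => /=.
by case: (q == _); case: (l == _); case: (r == _) => //= /(_ isT isT)[]; lia.
Qed.

Lemma occurs_set_rightmost x s q y : sided x s ->
  occurs y (set_rightmost s q) = (q == Some y) || occurs y s && (rightmost s != Some y).
Proof.
case: s => [p|[l r] sd] /=; first by rewrite andbN orbF.
have := sidedP sd (y := y) => /=; rewrite orbC.
by case: (q == _); case: (l == _); case: (r == _) => //= /(_ isT isT)[]; lia.
Qed.

Lemma occurs_relabel a b s y : a != b -> occurs y (relabel a b s) =
  if y == b then occurs a s || occurs b s else (y != a) && occurs y s.
Proof.
move=> ab; have f p : ((if p == Some a then Some b else p) == Some y) =
    if y == b then (p == Some a) || (p == Some b) else (y != a) && (p == Some y).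
  rewrite -![y == _](inj_eq (@Some_inj _)); have [->|pa] := eqVneq p (Some a).
    rewrite eq_sym; have [//|yb] := eqVneq (Some y) (Some b).
    by rewrite [Some a == _]eq_sym andNb.
  have [->|yb] := eqVneq (Some y) (Some b); first by [].
  have [->|ya] := eqVneq (Some y) (Some a); first by rewrite (negbTE pa).
  by [].
case: s => [p|[l r]] /=; rewrite !f //.
by case: ifP => _; [rewrite orbACA|rewrite andb_orr].
Qed.

Lemma sided_set_leftmost x s q : sided x s ->
  (two_ports s -> forall y, q = Some y -> y < x) -> sided x (set_leftmost s q).
Proof.
case: s => // -[l r] /= /andP[_ ->] h; rewrite andbT.
by case: q h => // y /(_ isT _ erefl).
Qed.

Lemma sided_set_rightmost x s q : sided x s ->
  (two_ports s -> forall y, q = Some y -> x < y) -> sided x (set_rightmost s q).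
Proof.
case: s => // -[l r] /= /andP[-> _] h.
by case: q h => // y /(_ isT _ erefl).
Qed.

Lemma sided_relabel x a b s : sided x s -> b != x ->
  (two_ports s -> occurs a s -> (a < x) = (b < x)) -> sided x (relabel a b s).
Proof.
case: s => // -[l r] /= /andP[ls rs] bx /(_ isT) h; apply/andP; split.
  by case: eqP => // la; rewrite -h ?la ?eqxx //; rewrite la in ls.
case: eqP => // ra; rewrite ra in rs h; move: h; rewrite eqxx orbT => /(_ isT) h.
by move: bx; rewrite neq_ltn -h ltnNge (ltnW rs).
Qed.

Lemma two_ports_set_leftmost s q : two_ports (set_leftmost s q) = two_ports s.
Proof. by case: s => // -[]. Qed.

Lemma two_ports_set_rightmost s q : two_ports (set_rightmost s q) = two_ports s.
Proof. by case: s => // -[]. Qed.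

Lemma two_ports_relabel a b s : two_ports (relabel a b s) = two_ports s.
Proof. by case: s => // -[]. Qed.

(** The labels decide which neighbor is left and which is right. Consequently the edges and the
    decoration determine a permutree. *)
Lemma ports_eq x s s' : sided x s -> sided x s' -> two_ports s = two_ports s' ->
  (forall y, occurs y s = occurs y s') -> s = s'.
Proof.
move=> ss ss' two eq.
have opt p q : (forall y, (p == Some y) = (q == Some y)) -> p = q.
  by case: p => [y /(_ y)|]; [rewrite eqxx => /esym/eqP|case: q => // y /(_ y); rewrite eqxx].
have ll : leftmost s = leftmost s'.
  by apply: opt => y; rewrite !(leftmostE _ (x := x)) // eq two.
have rr : rightmost s = rightmost s'.
  by apply: opt => y; rewrite !(rightmostE _ (x := x)) // eq two.
by case: s s' two ll rr {ss ss' eq} => [p|[l r]] [p'|[l' r']] //= _ -> // ->.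
Qed.

End Ports.

(** * The rotation of a permutree is a permutree with the same decoration *)

Section Rotate.

Variables (n : nat) (T : pretree n) (pT : is_permutree T) (i j : 'I_n).
Hypotheses (Eij : edge T i j) (Gij : i < j).

Let d := decoration_of T.
Let U := two_parents d.
Let D := two_children d.
Let G := @label_lt n.
Let E := edge T.
Let lG : linear_order G := label_lt_linear n.
Let tT : oriented_tree G E (direction T) U D := permutree_tree pT erefl.
Let lG' := converse_linear lG.
Let tT' := oriented_tree_dual lG tT.

Let sp x : sided x (parents T x). Proof. by case/andP: (permutree_sided pT x). Qed.
Let sc x : sided x (children T x). Proof. by case/andP: (permutree_sided pT x). Qed.

Let nij : i != j. Proof. by rewrite neq_ltn Gij. Qed.
Let nji : j != i. Proof. by rewrite eq_sym. Qed.

Let topE y : (leftmost (parents T j) == Some y) = rot_top G E U j y.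
Proof. by rewrite (leftmostE _ (sp j)) /rot_top /= /U two_parentsE. Qed.

Let botE y : (rightmost (children T i) == Some y) = rot_bot G E D i y.
Proof.
by rewrite (rightmostE _ (sc i)) /rot_bot /= /D two_childrenE -(permutree_edgeC pT).
Qed.

Let rightE : rightmost (parents T i) = Some j.
Proof.
by apply/eqP; rewrite (rightmostE _ (sp i)) -[occurs _ _]/(edge T i j) Eij Gij implybT.
Qed.

Let leftE : leftmost (children T j) = Some i.
Proof. by apply/eqP; rewrite (leftmostE _ (sc j)) -(permutree_edgeC pT) Eij Gij implybT. Qed.

Let irE x : E x x = false. Proof. exact: (tree_irr tT). Qed.
Let Eji : E j i = false. Proof. exact: (tree_asym tT). Qed.

Let topi : rot_top G E U j i = false. Proof. by rewrite /rot_top /= Eji. Qed.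
Let topj : rot_top G E U j j = false. Proof. by rewrite /rot_top /= irE. Qed.
Let boti : rot_bot G E D i i = false. Proof. by rewrite /rot_bot /= irE. Qed.
Let botj : rot_bot G E D i j = false. Proof. by rewrite /rot_bot /= Eji. Qed.

Lemma rotate_parents x y :
  occurs y (parents (rotate T i j) x) = rot_edge G E U D i j x y.
Proof.
rewrite /parents /= ffunE /rot_edge /=; have [->|xi] := eqVneq x i.
  rewrite (occurs_set_rightmost _ _ (sp i)) topE rightE boti (negbTE nij) /= andbT.
  by rewrite (inj_eq (@Some_inj _)) eq_sym.
have [->|xj] := eqVneq x j.
  rewrite (occurs_set_leftmost _ _ (sp j)) topE botj /= andbT.
  by rewrite (inj_eq (@Some_inj _)) eq_sym.
rewrite eq_sym botE; case: ifPn => [Bx|_]; last by rewrite /= andbT.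
have Exi : edge T x i by case/andP: Bx.
rewrite (occurs_relabel _ _ nij) /=.
rewrite -[occurs i _]/(edge T x i) Exi /=; have [yj|yj] //= := eqVneq y j.
by rewrite andbC.
Qed.

Lemma rotate_children x y :
  occurs x (children (rotate T i j) y) = rot_edge G E U D i j x y.
Proof.
rewrite /children /= ffunE /rot_edge /=; have [->|yi] := eqVneq y i.
  rewrite (occurs_set_rightmost _ _ (sc i)) botE topi (negbTE nij) !andbF /= !andbT.
  by rewrite (inj_eq (@Some_inj _)) eq_sym -(permutree_edgeC pT).
have [->|yj] := eqVneq y j.
  rewrite (occurs_set_leftmost _ _ (sc j)) botE leftE topj !andbF /= !andbT.
  by rewrite (inj_eq (@Some_inj _)) eq_sym -(permutree_edgeC pT).
rewrite eq_sym topE !andbF /=; case: ifPn => [Ty|_]; last first.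
  by rewrite !andbF /= !andbT -(permutree_edgeC pT).
have Ejy : edge T j y by case/andP: Ty.
rewrite (occurs_relabel _ _ nji) /= -!(permutree_edgeC pT) Ejy /= !andbT.
by have [xi|xi] //= := eqVneq x i; rewrite andbC.
Qed.

Let two_p x : two_ports (parents (rotate T i j) x) = two_ports (parents T x).
Proof.
rewrite {1}/parents /= ffunE; case: eqP => [->|_]; first exact: two_ports_set_rightmost.
case: eqP => [->|_]; first exact: two_ports_set_leftmost.
by case: ifP => // _; apply: two_ports_relabel.
Qed.

Let two_c x : two_ports (children (rotate T i j) x) = two_ports (children T x).
Proof.
rewrite {1}/children /= ffunE; case: eqP => [->|_]; first exact: two_ports_set_rightmost.
case: eqP => [->|_]; first exact: two_ports_set_leftmost.
by case: ifP => // _; apply: two_ports_relabel.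
Qed.

Lemma rotate_decoration : decoration_of (rotate T i j) = decoration_of T.
Proof.
by apply: decoration_ofP => x; rewrite ?two_parentsE ?two_childrenE.
Qed.

Lemma rotate_sided_parents x : sided x (parents (rotate T i j) x).
Proof.
rewrite /parents /= ffunE; have [->|xi] := eqVneq x i.
  apply: sided_set_rightmost => // two y /eqP; rewrite topE => Ay.
  have Ui : U i by rewrite /U two_parentsE.
  have := rot_top_side lG tT Eij Gij Ui Ay => /= /negbT; rewrite -leqNgt leq_eqVlt.
  by case/orP => // /eqP/val_inj iy; rewrite -iy topi in Ay.
have [->|xj] := eqVneq x j.
  by apply: sided_set_leftmost => // _ y [<-].
case: ifP => [|_]; last exact: sp.
rewrite eq_sym botE => /andP[Exi _]; apply: sided_relabel => //; first by rewrite eq_sym.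
move=> two _; have Ux : U x by rewrite /U two_parentsE.
exact: (rot_same_side tT Eij Ux Exi xj).
Qed.

Lemma rotate_sided_children x : sided x (children (rotate T i j) x).
Proof.
rewrite /children /= ffunE; have [->|xi] := eqVneq x i.
  by apply: sided_set_rightmost => // _ y [<-].
have [->|xj] := eqVneq x j.
  apply: sided_set_leftmost => // two y /eqP; rewrite botE => By.
  have Dj : D j by rewrite /D two_childrenE.
  have := rot_top_side lG' tT' (i := j) (j := i) Eij Gij Dj By => /= /negbT.
  rewrite -leqNgt leq_eqVlt.
  by case/orP => // /eqP/val_inj iy; rewrite iy botj in By.
case: ifP => [|_]; last exact: sc.
rewrite eq_sym topE => /andP[Ejx _]; apply: sided_relabel => //; first by rewrite eq_sym.
move=> two _; have Dx : D x by rewrite /D two_childrenE.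
have eq : (x < j) = (x < i) := rot_same_side tT' (i := j) (j := i) Eij Dx Ejx xi.
by move: xi xj eq; rewrite !neq_ltn /=; clear; lia.
Qed.

Lemma rotate_permutree : is_permutree (rotate T i j).
Proof.
have tR : oriented_tree G (edge (rotate T i j))
    (rot_dir G E (direction T) U D i j) U D.
  apply: oriented_tree_ext (rot_tree lG tT Eij Gij) => x y.
  by rewrite -rotate_parents.
apply: (tree_permutree tR).
- by move=> x y; rewrite rotate_parents rotate_children.
- by move=> x; rewrite /U two_parentsE two_p.
- by move=> x; rewrite /D two_childrenE two_c.
- exact: rotate_sided_parents.
- exact: rotate_sided_children.
Qed.

End Rotate.

(** * The permutree of the identity *)

Section Chain.

Variables (n : nat) (d : decoration n).
Implicit Types x y m : 'I_n.

Definition next x : option 'I_n := insub x.+1.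
(** The test is needed because [0.-1] is [0], which would create a loop. *)
Definition prev x : option 'I_n := if x == 0 :> nat then None else insub x.-1.

(* The path 0 -> 1 -> ... -> n-1, whose linear extension is the identity. *)
Definition chain : pretree n :=
  ([ffun x => if two_parents d x then inr (None, next x) else inl (next x)],
   [ffun x => if two_children d x then inr (prev x, None) else inl (prev x)]).

Definition chain_dir x m : 'I_n :=
  if x < m then odflt x (next x) else if m < x then odflt x (prev x) else x.

Lemma next_eq x y : (next x == Some y) = (y == x.+1 :> nat).
Proof.
rewrite /next; case: insubP => [z _ zE|/negbTE xn].
  by rewrite (inj_eq (@Some_inj _)) -(inj_eq val_inj) zE eq_sym.
by apply/esym/negP => /eqP yE; rewrite -yE ltn_ord in xn.
Qed.

Lemma prev_eq x y : (prev x == Some y) = (x == y.+1 :> nat).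
Proof.
rewrite /prev; have [->//|x0] := eqVneq (x : nat) 0; case: insubP => [z _ zE|/negbTE xn].
  by rewrite (inj_eq (@Some_inj _)) -(inj_eq val_inj) zE /=; lia.
by have := ltn_ord x; lia.
Qed.

Lemma chain_parents x y : occurs y (parents chain x) = (y == x.+1 :> nat).
Proof. by rewrite /parents ffunE; case: ifP => _ /=; rewrite next_eq. Qed.

Lemma chain_children x y : occurs x (children chain y) = (y == x.+1 :> nat).
Proof. by rewrite /children ffunE; case: ifP => _ /=; rewrite prev_eq ?orbF. Qed.

Lemma chain_dirE x m : chain_dir x m =
  (if x < m then x.+1 else if m < x then x.-1 else x) :> nat.
Proof.
rewrite /chain_dir; case: ltngtP => // xm.
  by rewrite /next; case: insubP => //=; have := ltn_ord m; lia.
rewrite /prev; case: eqP => [|_]; first by lia.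
by case: insubP => //=; have := ltn_ord x; lia.
Qed.

Lemma chain_edge x y : edge chain x y = (y == x.+1 :> nat).
Proof. exact: chain_parents. Qed.

Lemma chain_tree : oriented_tree (@label_lt n) (edge chain) chain_dir
  (two_parents d) (two_children d).
Proof.
split=> /=.
- by move=> x y; rewrite !chain_edge; lia.
- by move=> x; apply: val_inj; rewrite /= chain_dirE ltnn.
- move=> x m; rewrite neq_ltn !chain_edge chain_dirE /=; do 2?case: ifP; lia.
- move=> x y; rewrite !chain_edge => xy; apply: val_inj.
  by rewrite /= chain_dirE; do 2?case: ifP; lia.
- move=> x a b; rewrite !neq_ltn chain_edge /= => ax bx ab.
  by apply: val_inj; rewrite /= !chain_dirE; do 4?case: ifP; lia.
- have symc : connect_sym (sym_closure (edge chain)).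
    by apply: sym_connect_sym => u v /=; rewrite orbC.
  have up k : forall x y, y = x + k :> nat -> connect (sym_closure (edge chain)) x y.
    elim: k => [|k IH] x y yE.
      by rewrite (_ : y = x) //; apply: val_inj; rewrite /= yE addn0.
    have xn : x.+1 < n by have := ltn_ord y; lia.
    apply: connect_trans (IH (Ordinal xn) y _); last by rewrite /= yE; lia.
    by apply: connect1; rewrite /= chain_edge eqxx.
  move=> x y; case: (leqP x y) => xy; first by apply: (up (y - x)); lia.
  by rewrite symc; apply: (up (x - y)); lia.
- split=> [x y z|x m _]; rewrite /= !chain_edge; last first.
    by rewrite chain_dirE; do 2?case: ifP; lia.
  by move=> xy xz _; apply: val_inj; rewrite /=; lia.
- split=> [x y z|x m _]; rewrite /= !chain_edge; last first.
    by rewrite chain_dirE; do 2?case: ifP; lia.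
  by move=> xy xz _; apply: val_inj; rewrite /=; lia.
Qed.

Lemma chain_permutree : is_permutree chain && (decoration_of chain == d).
Proof.
have pE x : two_parents d x = two_ports (parents chain x).
  by rewrite /parents [chain.1 x]ffunE; case: ifP.
have cE x : two_children d x = two_ports (children chain x).
  by rewrite /children [chain.2 x]ffunE; case: ifP.
rewrite (decoration_ofP pE cE) eqxx andbT; apply: (tree_permutree chain_tree) => //.
- by move=> x y; rewrite chain_parents chain_children.
- move=> x; rewrite /parents /= ffunE; case: ifP => //= _.
  by rewrite /next; case: insubP => //= u _ ->.
- move=> x; rewrite /children /= ffunE; case: ifP => //= _.
  rewrite /prev; case: eqP => // x0; case: insubP => //= u _ ->; lia.
Qed.

End Chain.

(** Reversing the labels alone exchanges left and right; this turns results on minimal extensions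
    into results on maximal ones. *)
Lemma oriented_tree_converse (I : finType) (G E : rel I) dir U D :
    linear_order G ->
  oriented_tree G E dir U D -> oriented_tree (converse G) E dir U D.
Proof.
move=> lG tE; have irE := tree_irr tE; have dxx := dir_self tE.
case: (tE) => as_ _ da ad dc cn up dn; split=> //.
- exact: side_converse.
- exact: (side_converse lG (E := converse E)).
Qed.

Lemma linear_order_perm n (r : rel 'I_n) : linear_order r ->
  exists tau : 'S_n, forall x y, r x y = ((tau^-1)%g x < (tau^-1)%g y).
Proof.
move=> lr; have [irr trr totr] := lr.
have rank_lt x : #|[pred k | r k x]| < n.
  rewrite -[X in _ < X]card_ord; apply: proper_card; apply/properP; split.
    by apply/subsetP.
  by exists x; rewrite ?inE ?irr.
pose rank x : 'I_n := Ordinal (rank_lt x).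
have mono x y : r x y -> rank x < rank y.
  move=> xy; apply: proper_card; apply/properP; split.
    by apply/subsetP => k; rewrite !inE => kx; apply: trr kx xy.
  by exists x; rewrite !inE ?irr.
have inj : injective rank.
  move=> x y eq; apply/eqP; apply: contraT => /totr.
  by case/orP => /mono; rewrite eq ltnn.
(* Positions are values of the inverse permutation, and the position of a letter is its number of
   predecessors. *)
exists (perm inj)^-1%g => x y; rewrite invgK !permE.
apply/idP/idP => [/mono //|]; have [->|xy] := eqVneq x y; first by rewrite ltnn.
case/orP: (totr _ _ xy) => // /mono yx xy'.
by have := ltn_trans yx xy'; rewrite ltnn.
Qed.

Lemma perm_linear_order n (tau : 'S_n) :
  linear_order [rel x y : 'I_n | (tau^-1)%g x < (tau^-1)%g y].
Proof.
split=> [x|y x z|x y xy] /=; [exact: ltnn|exact: ltn_trans|].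
by rewrite -neq_ltn (inj_eq val_inj) (inj_eq perm_inj).
Qed.

(** * The permutree lattice *)

Section PermutreeLattice.

Variables (n : nat) (d : decoration n).
Implicit Types (T : permutree d) (r s t : rel 'I_n).

Let G := @label_lt n.
Let lG : linear_order G := label_lt_linear n.
Let lG' := converse_linear lG.

Definition tree_edge T : rel 'I_n := edge (val T).

Lemma permutree_val T : is_permutree (val T).
Proof. by case/andP: (valP T). Qed.

Lemma tree_edge_tree T : oriented_tree G (tree_edge T) (direction (val T))
  (two_parents d) (two_children d).
Proof. exact: (permutree_tree (permutree_val T) (eqP (proj2 (andP (valP T))))). Qed.

Let tT' T := oriented_tree_converse lG (tree_edge_tree T).

Lemma extension_inj T T' r : linear_order r ->
  extends r (tree_edge T) -> extends r (tree_edge T') -> T = T'.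
Proof.
move=> lr e e'; apply: val_inj.
have eqE := common_extension_eq lG (tree_edge_tree T) (tree_edge_tree T') lr e e'.
have pT := permutree_val T; have pT' := permutree_val T'.
have dT : decoration_of (val T) = d by case/andP: (valP T) => _ /eqP.
have dT' : decoration_of (val T') = d by case/andP: (valP T') => _ /eqP.
have pE x : parents (val T) x = parents (val T') x.
  have /andP[s1 _] := permutree_sided pT x; have /andP[s2 _] := permutree_sided pT' x.
  apply: ports_eq s1 s2 _ _ => [|y]; last exact: eqE.
  by rewrite -!two_parentsE dT dT'.
have cE x : children (val T) x = children (val T') x.
  have /andP[_ s1] := permutree_sided pT x; have /andP[_ s2] := permutree_sided pT' x.
  apply: ports_eq s1 s2 _ _ => [|y].
    by rewrite -!two_childrenE dT dT'.
  by rewrite -!permutree_edgeC //; apply: eqE.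
case: (val T) (val T') pE cE => [p c] [p' c'] /= pE cE.
by congr (_, _); apply/ffunP.
Qed.

Definition min_extension T := extremal G (tree_edge T).
Definition max_extension T := extremal (converse G) (tree_edge T).

Lemma min_extension_linear T : linear_order (min_extension T).
Proof. exact: (extremal_linear lG (tree_edge_tree T)). Qed.

Lemma max_extension_linear T : linear_order (max_extension T).
Proof. exact: (extremal_linear lG' (tT' T)). Qed.

Lemma min_extension_extends T : extends (min_extension T) (tree_edge T).
Proof. exact: (extremal_extends (tree_edge_tree T)). Qed.

Lemma max_extension_extends T : extends (max_extension T) (tree_edge T).
Proof. exact: (extremal_extends (tree_edge_tree T)). Qed.

Lemma min_extension_le T r : linear_order r -> extends r (tree_edge T) ->
  weak_le G (min_extension T) r.
Proof. exact: extremal_least. Qed.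

Lemma max_extension_ge T r : linear_order r -> extends r (tree_edge T) ->
  weak_le G r (max_extension T).
Proof.
move=> lr e; apply: (weak_le_converse lG (max_extension_linear T) lr).
exact: extremal_least.
Qed.

Lemma weak_le_rotations T r s :
    linear_order r -> linear_order s -> weak_le G r s -> extends r (tree_edge T) ->
  exists2 T', extends s (tree_edge T') & permutree_le T T'.
Proof.
move=> lr ls rs e.
apply: (weak_le_ind (P := fun q => exists2 T', extends q (tree_edge T') & permutree_le T T')
  lG lr ls rs) => [q q' eq [T' e' le']|q i j lq Gij cons [T' e' le']|].
- by exists T' => // x y /e'; rewrite eq.
- have [Eij|nEij] := boolP (tree_edge T' i j); last first.
    by exists T' => //; apply: swap_extends.
  have pT' := permutree_val T'.
  have pR : is_permutree (rotate (val T') i j) &&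
      (decoration_of (rotate (val T') i j) == d).
    rewrite rotate_permutree // rotate_decoration.
    by case/andP: (valP T').
  exists (Sub (rotate (val T') i j) pR).
    have := rot_swap_extends lq (tree_edge_tree T') Eij (linear_neq lG Gij) e' cons.
    move=> eR x y; rewrite /tree_edge SubK /edge /= (rotate_parents pT' Eij Gij) => xy.
    apply: eR; move: xy; rewrite (eqP (proj2 (andP (valP T')))); exact.
  apply: connect_trans le' (connect1 _).
  apply/existsP; exists i; apply/existsP; exists j.
  by rewrite SubK eqxx andbT; apply/andP.
- by exists T => //; apply: connect0.
Qed.

(** The identity is the minimum of the weak order and extends the chain, so rotations lead from the
    chain to a permutree extended by [r]. *)
Lemma extension_exists r : linear_order r -> exists T, extends r (tree_edge T).
Proof.
move=> lr; pose T0 : permutree d := Sub (chain d) (chain_permutree d).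
have e0 : extends G (tree_edge T0).
  by move=> x y; rewrite /tree_edge SubK chain_edge => /eqP xy; rewrite /G /= xy.
have le0 : weak_le G G r by move=> x y xy yx; have := linear_asym lG xy; rewrite yx.
by have [T e _] := weak_le_rotations lG lr le0 e0; exists T.
Qed.

Lemma weak_le_permutree T T' r s :
    linear_order r -> linear_order s -> weak_le G r s ->
  extends r (tree_edge T) -> extends s (tree_edge T') -> permutree_le T T'.
Proof.
move=> lr ls rs e e'; have [T1 e1 le1] := weak_le_rotations lr ls rs e.
by rewrite (extension_inj ls e' e1).
Qed.

(** Every rotation comes from a swap: some linear extension has [i] and [j] in consecutive
    positions, and [extremal_mono] compares it with its swap. *)
Lemma permutree_le_extensions T T' : permutree_le T T' ->
  weak_le G (min_extension T) (min_extension T') /\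
  weak_le G (max_extension T) (max_extension T').
Proof.
case/connectP=> p; elim: p T => [|T1 p IH] T /=; first by move=> _ ->; split=> x y.
case/andP=> /existsP[i /existsP[j /and3P[ij Eij /eqP T1E]]] pT1 lT'.
have [m1 m2] := IH _ pT1 lT'.
have tT := tree_edge_tree T; have pT := permutree_val T.
have [r [lr er cr]] := edge_consecutive_extension lG tT Eij.
have e1 : extends (swap r i j) (tree_edge T1).
  have eR := rot_swap_extends lr tT Eij (linear_neq lG ij) er cr.
  move=> x y; rewrite /tree_edge T1E /edge /= (rotate_parents pT Eij ij) => xy.
  apply: eR; move: xy; rewrite (eqP (proj2 (andP (valP T)))); exact.
have [l1 l2] := extremal_mono lG tT (tree_edge_tree T1) lr (swap_linear lr cr) er e1
  (swap_weak_le (r := r) lG ij).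
by split; [apply: weak_le_trans l1 m1|apply: weak_le_trans l2 m2].
Qed.

Lemma permutree_le_anti : antisymmetric (@permutree_le n d).
Proof.
move=> T T' /andP[/permutree_le_extensions[le1 _] /permutree_le_extensions[le2 _]].
have lT := min_extension_linear T; have lT' := min_extension_linear T'.
apply: (extension_inj lT (@min_extension_extends T)) => x y /min_extension_extends.
by rewrite (weak_le_anti lG lT lT' le1 le2).
Qed.

(** The maximal extension of an upper bound of [T1] and [T2] lies above those of [T1] and [T2],
    hence above [r], [s] and their weak join. The freedom in the choice of [r] and [s] is what
    [refinement_hom] exploits. *)
Lemma weak_join_permutree T1 T2 T r s :
    linear_order r -> linear_order s ->
    extends r (tree_edge T1) -> extends s (tree_edge T2) ->
    extends (weak_join G r s) (tree_edge T) ->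
  is_join (@permutree_le n d) T1 T2 T.
Proof.
move=> lr ls e1 e2 e; have lj := weak_join_linear lG lr ls.
have [ub1 ub2] := weak_join_ub r s lG.
split; [exact: weak_le_permutree ub1 e1 e|exact: weak_le_permutree ub2 e2 e|].
move=> T' /permutree_le_extensions[_ le1] /permutree_le_extensions[_ le2].
have lM := max_extension_linear T'.
apply: (weak_le_permutree lj lM _ e (@max_extension_extends T')).
apply: weak_join_least => //.
  exact: weak_le_trans (max_extension_ge lr e1) le1.
exact: weak_le_trans (max_extension_ge ls e2) le2.
Qed.

Lemma weak_meet_permutree T1 T2 T r s :
    linear_order r -> linear_order s ->
    extends r (tree_edge T1) -> extends s (tree_edge T2) ->
    extends (weak_join (converse G) r s) (tree_edge T) ->
  is_meet (@permutree_le n d) T1 T2 T.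
Proof.
move=> lr ls e1 e2 e; have lj := weak_join_linear lG' lr ls.
have [lb1 lb2] := weak_join_ub r s lG'.
split.
- exact: weak_le_permutree lj lr (weak_le_converse lG lr lj lb1) e e1.
- exact: weak_le_permutree lj ls (weak_le_converse lG ls lj lb2) e e2.
move=> T' /permutree_le_extensions[le1 _] /permutree_le_extensions[le2 _].
have lM := min_extension_linear T'.
apply: (weak_le_permutree lM lj _ (@min_extension_extends T') e).
apply: (weak_le_converse lG lj lM); apply: weak_join_least => //.
  apply: (weak_le_converse lG' lM lr).
  exact: weak_le_trans le1 (min_extension_le lr e1).
apply: (weak_le_converse lG' lM ls).
exact: weak_le_trans le2 (min_extension_le ls e2).
Qed.

Lemma permutree_lattice : is_lattice (@permutree_le n d).
Proof.
split; [exact: connect0|exact: permutree_le_anti|exact: connect_trans|].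
move=> T1 T2.
have l1 := min_extension_linear T1; have l2 := min_extension_linear T2.
have e1 := @min_extension_extends T1; have e2 := @min_extension_extends T2.
split.
  have [T e] := extension_exists (weak_join_linear lG' l1 l2).
  by exists T; apply: weak_meet_permutree e1 e2 e.
have [T e] := extension_exists (weak_join_linear lG l1 l2).
by exists T; apply: weak_join_permutree e1 e2 e.
Qed.

Lemma is_meet_unique T1 T2 T T' : is_meet (@permutree_le n d) T1 T2 T ->
  is_meet (@permutree_le n d) T1 T2 T' -> T = T'.
Proof.
case=> a1 a2 a [b1 b2 b]; apply: permutree_le_anti.
by apply/andP; split; [apply: b|apply: a].
Qed.

Lemma is_join_unique T1 T2 T T' : is_join (@permutree_le n d) T1 T2 T ->
  is_join (@permutree_le n d) T1 T2 T' -> T = T'.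
Proof.
case=> a1 a2 a [b1 b2 b]; apply: permutree_le_anti.
by apply/andP; split; [apply: a|apply: b].
Qed.

End PermutreeLattice.

(** * The refinement map *)

Section Refinement.

Variables (n : nat) (d d' : decoration n) (dd' : refines d d').
Implicit Types (T : permutree d) (r s t : rel 'I_n).

Let G := @label_lt n.
Let lG : linear_order G := label_lt_linear n.

(** The condition is boolean so that [xchoose] can turn existence into a function. *)
Lemma refinement_exists T :
  exists T' : permutree d', [forall x, forall y, tree_edge T' x y ==> min_extension T x y].
Proof.
have [T' e] := extension_exists d' (min_extension_linear T).
by exists T'; apply/forallP => x; apply/forallP => y; apply/implyP => /e.
Qed.

Definition refinement T : permutree d' := xchoose (refinement_exists T).

Lemma refinement_min T : extends (min_extension T) (tree_edge (refinement T)).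
Proof.
move=> x y; have /forallP/(_ x)/forallP/(_ y)/implyP := xchooseP (refinement_exists T).
exact.
Qed.

(** The refinement and [T] share the minimal extension of [T], through which every relation of the
    refinement is seen to be a relation of [T]. *)
Lemma refinement_extends T r :
  linear_order r -> extends r (tree_edge T) -> extends r (tree_edge (refinement T)).
Proof.
move=> lr e x y xy.
have tR := tree_edge_tree (refinement T).
have sym x0 : (two_parents d x0 -> two_parents d' x0) /\
              (two_children d x0 -> two_children d' x0).
  have /forallP/(_ x0) := dd'; rewrite /two_parents /two_children /=.
  by case: (d x0); case: (d' x0).
have := @common_extension_sub _ _ _ _ _ _ _ _ _ _ lG (tree_edge_tree T) tR _
  (min_extension_linear T) (@min_extension_extends _ _ T) (@refinement_min T)
  (fun x0 => (sym x0).1) (fun x0 => (sym x0).2) x y.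
rewrite /= (edge_neq tR xy) connect1 // => /(_ isT)/andP[_ c].
exact: (extends_connect lr e c (edge_neq tR xy)).
Qed.

Lemma refinement_map : is_refinement_map refinement.
Proof.
move=> T T'; split=> [<- tau ext|sub].
  exact: (refinement_extends (perm_linear_order tau)).
(* One common linear extension already identifies [T']; the permutation of the minimal extension of
   [T] provides it. *)
have lm := min_extension_linear T; have [tau tauE] := linear_order_perm lm.
apply: (extension_inj lm (@refinement_min T)) => x y; rewrite tauE; apply: sub => i j ij.
by rewrite -tauE; apply: min_extension_extends.
Qed.

Lemma refinement_surj (T' : permutree d') : exists T, refinement T = T'.
Proof.
have lm := min_extension_linear T'; have [T e] := extension_exists d lm.
exists T; apply: (extension_inj lm); last exact: min_extension_extends.
exact: refinement_extends.
Qed.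

(** The words [r], [s] and their weak join or meet extend both the permutrees of decoration [d] and
    their refinements, so they compute the join or meet in both lattices; uniqueness identifies the
    given bound with the computed one. *)
Lemma refinement_hom :
  is_lattice_hom (@permutree_le n d) (@permutree_le n d') refinement.
Proof.
move=> T1 T2 T.
have l1 := min_extension_linear T1; have l2 := min_extension_linear T2.
have e1 := @min_extension_extends _ _ T1; have e2 := @min_extension_extends _ _ T2.
have lm := weak_join_linear (converse_linear lG) l1 l2.
have lj := weak_join_linear lG l1 l2.
have re T0 r (lr : linear_order r) (e : extends r (tree_edge T0)) :=
  refinement_extends lr e.
split=> glb.
  have [T0 e0] := extension_exists d lm.
  rewrite (is_meet_unique glb (weak_meet_permutree l1 l2 e1 e2 e0)).
  exact: weak_meet_permutree l1 l2 (re _ _ l1 e1) (re _ _ l2 e2) (re _ _ lm e0).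
have [T0 e0] := extension_exists d lj.
rewrite (is_join_unique glb (weak_join_permutree l1 l2 e1 e2 e0)).
exact: weak_join_permutree l1 l2 (re _ _ l1 e1) (re _ _ l2 e2) (re _ _ lj e0).
Qed.

End Refinement.

Theorem proposition35 (n : nat) (d d' : decoration n) (hdd' : refines d d') :
  is_lattice (@permutree_le n d) /\
  is_lattice (@permutree_le n d') /\
  exists Psi : permutree d -> permutree d',
    [/\ is_refinement_map Psi,
        (forall T' : permutree d', exists T : permutree d, Psi T = T')
      & is_lattice_hom (@permutree_le n d) (@permutree_le n d') Psi].
Proof.
split; first exact: permutree_lattice.
split; first exact: permutree_lattice.
exists (@refinement n d d'); split.
- exact: refinement_map.
- exact: refinement_surj.
- exact: refinement_hom.
Qed.
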